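(* Let $d\ge 1$, let $(X,\mathrm{d}\mu)$ be a $\sigma$-finite measure space and let $Y_1,\dots,Y_d$ be measure spaces. Let $1\le r_j\le\infty$ and $\gamma_j>0$ for $1\le j\le d$. Let $T_j:\mathcal{S}(Y_j)\to\mathcal{M}(X)$ be positive linear operators, each of which saturates $X$. Suppose that $$\int_X\prod_{j=1}^d (T_jf_j)(x)^{\gamma_j}\,\mathrm{d}\mu(x)\le A^{\sum_{j=1}^d\gamma_j}\prod_{j=1}^d\|f_j\|_{L^{r_j}(Y_j)}^{\gamma_j}$$ for all nonnegative simple functions $f_j\in\mathcal{S}(Y_j)$, $1\le j\le d$. Then for every $(p_j)_{j=1}^d$ satisfying $0<p_j<\infty$ for all $j$, $\sum_{j=1}^d\gamma_j/p_j=1$, and $p_j\le r_j$ for all $j$, there exist nonnegative measurable functions $\phi_1,\dots,\phi_d$ on $X$ such that $$\prod_{j=1}^d\phi_j(x)^{\gamma_j/p_j}\ge 1\quad\text{for a.e. }x\in X,$$ and such that for each $j$, $$\left(\int_X|T_jf_j(x)|^{p_j}\phi_j(x)\,\mathrm{d}\mu(x)\right)^{1/p_j}\le A\|f_j\|_{L^{r_j}(Y_j)}\quad\text{for all } f_j\in\mathcal{S}(Y_j).$$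
   Context: $\mathcal{M}(X)$ is the class of measurable functions on $X$. $\mathcal{S}(Y_j)$ is the space of simple functions on $Y_j$ (with finite norm), equipped with the $L^{r_j}(Y_j)$-norm. A linear operator is positive if it maps nonnegative functions to (a.e.) nonnegative functions. A linear map $T:\mathcal{Y}\to\mathcal{M}(X)$ saturates $X$ if for each measurable $E\subseteq X$ of positive measure there exist a measurable $E'\subseteq E$ with $\mu(E')>0$ and an $h\in\mathcal{Y}$ such that $|Th|>0$ a.e. on $E'$. *)

(* Defs.v *)
From HB Require Import structures.
From mathcomp Require Import all_boot all_order all_algebra.
From mathcomp Require Import all_classical all_reals all_analysis.

Set Implicit Arguments.
Unset Strict Implicit.
Unset Printing Implicit Defensive.

Import Order.TTheory GRing.Theory Num.Theory.
Import numFieldNormedType.Exports.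
Import HBSimple.

Local Open Scope classical_set_scope.
Local Open Scope ring_scope.

Definition simple_space {R : realType} {dY : measure_display}
    {Y : measurableType dY} (nu : {measure set Y -> \bar R}) (r : \bar R)
    : set {sfun Y >-> R} :=
  [set f | finite_norm nu r f].

(* An operator on a set [S] of simple functions is represented by a total
   function on simple functions whose values outside [S] are never used.
   Measurable functions are identified when they agree almost everywhere, hence
   linearity and positivity are required up to null sets. *)
Section operators.
Context {R : realType} {dX dY : measure_display}
  {X : measurableType dX} {Y : measurableType dY}.
Variables (mu : {measure set X -> \bar R}) (S : set {sfun Y >-> R})
  (T : {sfun Y >-> R} -> {mfun X >-> R}).

Definition linear_operator : Prop :=
  forall (a : R) (f g : {sfun Y >-> R}), S f -> S g ->
    {ae mu, forall x, T (scale_sfun a f + g) x = a * T f x + T g x}.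

Definition positive_operator : Prop :=
  forall f : {sfun Y >-> R}, S f -> (forall y, 0 <= f y) ->
    {ae mu, forall x, 0 <= T f x}.

Definition saturates : Prop :=
  forall E : set X, measurable E -> (0 < mu E)%E ->
    exists E' : set X, [/\ measurable E', E' `<=` E, (0 < mu E')%E &
      exists h : {sfun Y >-> R},
        S h /\ {ae mu, forall x, E' x -> 0 < `|T h x|}].

End operators.

(* Main.v *)
Require Import Defs.
From HB Require Import structures.
From mathcomp Require Import all_boot all_order all_algebra.
From mathcomp Require Import all_classical all_reals all_analysis.
From mathcomp Require Import measurable_realfun ess_sup_inf.
From mathcomp Require Import ring lra.

Set Implicit Arguments.
Unset Strict Implicit.
Unset Printing Implicit Defensive.

Import Order.TTheory GRing.Theory Num.Theory.
Import numFieldNormedType.Exports.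
Import HBSimple.

Local Open Scope classical_set_scope.
Local Open Scope ring_scope.

(** Put [theta j = gamma j / p j], so that the [theta j] have sum [1], and let
    [C j] be the set of the nonnegative functions [u] on [X] with
    [u <= (T j f / A) ^ (p j)] for some nonnegative simple [f] of norm at most [1].
    Here [A] is positive: if [A = 0], the hypothesis and saturation force [X] to be
    a null space ([joint_saturation], [level_bound]).  The hypothesis says that [\int \prod_j u j ^ theta j <= 1] whenever
    [u j] is in [C j] for all [j], and weights [phi j] are wanted with
    [\prod_j phi j ^ theta j >= 1] and [\int v phi j <= 1] for all [v] in [C j].

    If the functional [G u = \int \prod_j u j ^ theta j] had a maximizer [u]
    with positive entries, the weights [phi j = (\prod_k u k ^ theta k) / u j] would
    solve the problem.  Indeed [\prod_j phi j ^ theta j = 1] because the [theta j]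
    have sum [1]; and, the [C j] being convex, [u] can be moved towards any [v] in
    [C j], so that the derivative of [G] in this direction is nonpositive, which
    reads [\int v phi j <= G u <= 1].

    A maximizer need not exist, and its entries could vanish.  Fix therefore a tuple
    [c] and a bound [K], and use a near maximizer among the tuples [(1 - e) a + e c].
    Its dual weights have geometric mean [1] where [c] is positive, and satisfy
    [\int v phi j <= 1 + 1 / K] for those [v] in [C j] with [v <= K c j]
    ([near_maximizer]).  For each [(c, K)] the weights with these two properties form
    a convex set, and these sets shrink as [(c, K)] grows.  Minimizing a strictly
    convex functional along them yields one limit point common to all these sets
    ([convex_compactness]).  It satisfies the integral bounds by Fatou's lemma;
    saturation shows first that it is finite, then that its geometric mean is at
    least [1] almost everywhere ([factorisation]).

    The convexity of [C j] is where positivity of [T j] and [p j <= r j] enter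
    ([level_convex]).  With [q = max 1 (p j)], a positive operator satisfies
    [((1 - t) (T f) ^ q + t (T g) ^ q) ^ (1 / q) <= T h] for
    [h = ((1 - t) f ^ q + t g ^ q) ^ (1 / q)] ([op_pmean]), while the unit ball of
    [L ^ r] is stable under this power mean since [q <= r] ([Lnorm_pmean]). *)

(** * Integrals of nonnegative real functions, a finite weight, summability *)

Section real_integrals.
Context d (X : measurableType d) (R : realType).
Variable mu : {measure set X -> \bar R}.
Implicit Types f g : X -> R.

Lemma integral_fin_ge0 f : (forall x, 0 <= f x) -> (0 <= \int[mu]_x (f x)%:E)%E.
Proof. by move=> f0; apply: integral_ge0 => x _; rewrite lee_fin. Qed.

Lemma integralZl_fin f k : measurable_fun setT f -> (forall x, 0 <= f x) -> 0 <= k ->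
  (\int[mu]_x (k * f x)%:E = k%:E * \int[mu]_x (f x)%:E)%E.
Proof.
move=> mf f0 k0; under eq_integral do rewrite EFinM.
apply: ge0_integralZl_EFin => //; first by move=> x _; rewrite lee_fin.
exact/measurable_EFinP.
Qed.

Lemma integralD_fin f g : measurable_fun setT f -> measurable_fun setT g ->
  (forall x, 0 <= f x) -> (forall x, 0 <= g x) ->
  (\int[mu]_x (f x + g x)%:E = \int[mu]_x (f x)%:E + \int[mu]_x (g x)%:E)%E.
Proof.
move=> mf mg f0 g0; under eq_integral do rewrite EFinD.
apply: ge0_integralD => //; do ?[by move=> x _; rewrite lee_fin];
  exact/measurable_EFinP.
Qed.

Lemma ae_le_integral_fin f g : measurable_fun setT f -> measurable_fun setT g ->
  (forall x, 0 <= f x) -> (forall x, 0 <= g x) ->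
  {ae mu, forall x, f x <= g x} ->
  (\int[mu]_x (f x)%:E <= \int[mu]_x (g x)%:E)%E.
Proof.
move=> mf mg f0 g0 fg; apply: ae_ge0_le_integral => //;
  do ?[by move=> x _; rewrite lee_fin]; do ?exact/measurable_EFinP.
by apply: filterS fg => x fgx _; rewrite lee_fin.
Qed.

Lemma le_integral_fin f g : measurable_fun setT f -> measurable_fun setT g ->
  (forall x, 0 <= f x) -> (forall x, f x <= g x) ->
  (\int[mu]_x (f x)%:E <= \int[mu]_x (g x)%:E)%E.
Proof.
move=> mf mg f0 fg; apply: ae_le_integral_fin => //; last exact/aeW.
by move=> x; rewrite (le_trans (f0 x)).
Qed.

End real_integrals.

Section weight.
Context d (X : measurableType d) (R : realType).

(** A weight with finite integral lets an arbitrary sigma-finite measure be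
    treated as a finite one: it is the sum of the indicators of the sets of a
    countable cover of finite measure, with coefficients chosen so that the
    [n]-th term and its integral are both at most [1 / 2 ^ n.+1]. *)
Lemma sigma_finite_weight (mu : {sigma_finite_measure set X -> \bar R}) :
  exists w : X -> R, [/\ measurable_fun setT w, forall x, 0 < w x &
    (\int[mu]_x (w x)%:E <= 1%:E)%E].
Proof.
have [F UF mF] := sigma_finiteT mu.
pose c n : R := (2 ^ n.+1)%:R^-1 / (1 + fine (mu (F n))).
have muF0 n : 0 <= fine (mu (F n)) by rewrite fine_ge0.
have d0 n : 0 < 1 + fine (mu (F n)) by rewrite ltr_pwDl.
have c0 n : 0 < c n by rewrite divr_gt0// invr_gt0 ltr0n expn_gt0.
have cle n : c n <= 1 / (2 ^ n.+1)%:R.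
  rewrite /c div1r ler_piMr// invf_le1// lerDl//.
pose t n x : \bar R := (c n * \1_(F n) x)%:E.
have t0 n x : (0 <= t n x)%E.
  by rewrite lee_fin mulr_ge0// ltW.
have mt n : measurable_fun setT (t n : X -> \bar R).
  apply/measurable_EFinP; apply: measurable_funM => //.
  by apply: measurable_indic; have [] := mF n.
pose we x : \bar R := (\sum_(n <oo) t n x)%E.
have we1 x : (we x <= 1%:E)%E.
  apply: le_trans (epsilon_trick0 xpredT ler01).
  apply: lee_nneseries => [n _ _|n _]; first exact: t0.
  rewrite lee_fin (le_trans _ (cle n))//; apply: ler_piMr; first exact: ltW.
  by rewrite indicE lern1 leq_b1.
have wepos x : (0 < we x)%E.
  have : setT x by [].
  rewrite UF => -[n _ Fnx].
  have := @nneseries_lim_ge R (fun n => t n x) xpredT 0 n.+1 (fun k _ _ => t0 k x).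
  apply: lt_le_trans; rewrite big_nat_recr//=.
  apply: (@lt_le_trans _ _ (t n x)); last first.
    by rewrite leeDr// sume_ge0// => k _; exact: t0.
  by rewrite lte_fin indicE mem_set// mulr1.
have wefin x : we x \is a fin_num.
  by rewrite ge0_fin_numE ?ltW//; apply: le_lt_trans (we1 x) _; rewrite ltry.
exists (fine \o we); split.
- apply: measurableT_comp => //; apply: ge0_emeasurable_sum => //.
- by move=> x /=; rewrite fine_gt0// wepos ltey_eq wefin.
- under eq_integral => x _ do rewrite /= fineK//.
  rewrite integral_nneseries//.
  apply: le_trans (epsilon_trick0 xpredT ler01).
  apply: lee_nneseries => [n _ _|n _]; first exact: integral_ge0.
  have [mFn muFn] := mF n.
  rewrite integralZl_fin//; last by rewrite ltW.
  have -> : (\int[mu]_x (\1_(F n) x)%:E = (fine (mu (F n)))%:E)%E.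
    by rewrite integral_indic// setIT fineK// ge0_fin_numE.
  rewrite -EFinM lee_fin /c div1r -mulrA ler_piMr//.
  by rewrite mulrC ler_pdivrMr// mul1r lerDr.
Qed.

End weight.

Section summable.
Context d (X : measurableType d) (R : realType).
Variable mu : {measure set X -> \bar R}.

Lemma ae_summable (a : nat -> X -> R) (C : R) : 0 <= C ->
  (forall n, measurable_fun setT (a n)) -> (forall n x, 0 <= a n x) ->
  (forall n, (\int[mu]_x (a n x)%:E <= (C / (2 ^ n.+1)%:R)%:E)%E) ->
  {ae mu, forall x, cvgn (series (a ^~ x))}.
Proof.
move=> C0 ma a0 ia.
have ea0 n x : (0 <= (a n x)%:E)%E by rewrite lee_fin.
have mea n : measurable_fun setT (fun x => (a n x)%:E).
  by apply/measurable_EFinP.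
have : mu.-integrable setT (fun x => \sum_(n <oo) (a n x)%:E)%E.
  apply/integrableP; split; first exact: ge0_emeasurable_sum.
  under eq_integral do rewrite gee0_abs ?nneseries_ge0//.
  rewrite integral_nneseries//; apply: (@le_lt_trans _ _ C%:E); last exact: ltry.
  apply: le_trans (epsilon_trick0 xpredT C0).
  by apply: lee_nneseries => [n _ _|n _ //]; exact: integral_ge0.
move/(integrable_ae measurableT); apply: filterS => x /(_ I) fx.
apply: nondecreasing_is_cvgn.
  by apply/nondecreasing_series => n _ _.
exists (fine (\sum_(n <oo) (a n x)%:E)%E) => _ [n _ <-].
rewrite -lee_fin fineK// /series/= -sumEFin.
exact: nneseries_lim_ge.
Qed.

(** A quantitative form of the completeness of weighted [L^2]: square norms
    that decay like [8 ^ - n] leave room for the factors [2 ^ n] in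
    [w |a| <= (2 ^ n w a ^ 2 + 2 ^ - n w) / 2], so the weighted [L^1] norms are
    still summable and no subsequence has to be extracted. *)
Lemma ae_summable_sqr (w : X -> R) (a : nat -> X -> R) :
  measurable_fun setT w -> (forall x, 0 < w x) ->
  (\int[mu]_x (w x)%:E <= 1%:E)%E ->
  (forall n, measurable_fun setT (a n)) ->
  (forall n, (\int[mu]_x (w x * a n x ^+ 2)%:E <= (4 * (8 ^ n)%:R^-1)%:E)%E) ->
  {ae mu, forall x, cvgn [normed series (a ^~ x)]}.
Proof.
move=> mw w0 iw ma ia.
pose b n x := w x * `|a n x|.
have mb n : measurable_fun setT (b n).
  by apply: measurable_funM => //; exact: measurableT_comp.
have b0 n x : 0 <= b n x by rewrite mulr_ge0// ltW.
have ib n : (\int[mu]_x (b n x)%:E <= (5%:R / (2 ^ n.+1)%:R)%:E)%E.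
  pose u : R := 2 ^+ n; have u0 : 0 < u by rewrite exprn_gt0.
  have pos1 x : 0 <= 2^-1 * u * (w x * a n x ^+ 2).
    by do 2! apply: mulr_ge0; rewrite ?sqr_ge0 ?invr_ge0 ?ltW.
  have pos2 x : 0 <= 2^-1 * u^-1 * w x.
    by apply: mulr_ge0; [apply: mulr_ge0|]; rewrite ?invr_ge0 ?ltW.
  have mwa : measurable_fun setT (fun x => w x * a n x ^+ 2).
    by apply: measurable_funM => //; exact: measurable_funX.
  have m1 : measurable_fun setT (fun x => 2^-1 * u * (w x * a n x ^+ 2)).
    exact: measurable_funM.
  have m2 : measurable_fun setT (fun x => 2^-1 * u^-1 * w x).
    exact: measurable_funM.
  apply: (@le_trans _ _ (\int[mu]_x (2^-1 * u * (w x * a n x ^+ 2) +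
    2^-1 * u^-1 * w x)%:E)%E).
    apply: le_integral_fin => //; first exact: measurable_funD.
    move=> x; rewrite /b.
    have -> : 2^-1 * u * (w x * a n x ^+ 2) + 2^-1 * u^-1 * w x =
      w x * (2^-1 * (u * a n x ^+ 2 + u^-1)) by ring.
    apply: ler_wpM2l; first by rewrite ltW.
    rewrite -[a n x ^+ 2]real_normK ?num_real//.
    set y := `|a n x|.
    have : 0 <= u^-1 * (u * y - 1) ^+ 2 by rewrite mulr_ge0 ?sqr_ge0// invr_ge0 ltW.
    have -> : u^-1 * (u * y - 1) ^+ 2 = u * y ^+ 2 - 2 * y + u^-1.
      by field; rewrite gt_eqF.
    by move=> ?; lra.
  rewrite integralD_fin// !integralZl_fin//.
  2: by move=> x; rewrite ltW.
  2: by rewrite mulr_ge0// invr_ge0 ltW.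
  2: by move=> x; apply: mulr_ge0; rewrite ?sqr_ge0 ?ltW.
  2: by rewrite mulr_ge0// ltW.
  apply: (@le_trans _ _ ((2^-1 * u)%:E * (4 * (8 ^ n)%:R^-1)%:E +
    (2^-1 * u^-1)%:E * 1%:E)%E).
    by apply: leeD; apply: lee_wpmul2l => //;
      rewrite lee_fin mulr_ge0// ?invr_ge0 ltW.
  rewrite -!EFinM -EFinD lee_fin !natrX exprS.
  rewrite -/u; have -> : (8 : R) ^+ n = u ^+ 3 by rewrite /u -exprM mulnC exprM; congr (_ ^+ n); ring.
  have u1 : u^-1 <= 1 by rewrite invf_le1// exprn_ege1// ler1n.
  have -> : 2^-1 * u * (4 * u ^- 3) + 2^-1 * u^-1 * 1 = 2^-1 * u^-1 * (4 * u^-1 + 1).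
    by field; rewrite gt_eqF.
  rewrite invfM mulrC ler_wpM2r//; last lra.
  by rewrite mulr_ge0// invr_ge0 ltW.
have := ae_summable (ler0n _ 5) mb b0 ib.
apply: filterS => x /= h.
have -> : [normed series (a ^~ x)] = series ((w x)^-1 *: (b ^~ x)).
  congr series; apply/funext => n /=.
  by rewrite /b fctE /= /GRing.scale/= mulrA mulVf ?mul1r// gt_eqF.
exact: is_cvg_seriesZ.
Qed.

End summable.

(** * Compactness of midpoint-convex families of nonnegative functions *)

(** Bounded convex sets of nonnegative measurable functions have no compactness
    for convergence almost everywhere, yet a downward directed family of nonempty
    midpoint-convex ones has a common limit point, provided that the value [+oo]
    is allowed.  The limit is found by minimizing the strictly convex functional
    [V phi = \sum_j \int w exp (- phi j)]: the minima of [V] over the sets of the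
    family increase to some [s], and near minimizers far along the family are
    forced by strict convexity to be close to each other.  The functions [phi]
    are recorded through [exp (- phi / 2)], which turns the value [+oo] into [0]
    and the convexity of [V] into the parallelogram identity. *)
Section convex_compactness.
Context d (X : measurableType d) (R : realType).
Variable mu : {sigma_finite_measure set X -> \bar R}.
Variables (J : finType) (I : Type) (Phi : I -> set (J -> X -> R)).
Hypothesis Phi_nonempty : forall i, Phi i !=set0.
Hypothesis Phi_directed : forall i k, exists l, Phi l `<=` Phi i `&` Phi k.
Hypothesis Phi_measurable :
  forall i phi, Phi i phi -> forall j, measurable_fun setT (phi j).
Hypothesis Phi_ge0 : forall i phi, Phi i phi -> forall j x, 0 <= phi j x.
Hypothesis Phi_midpoint : forall i phi psi, Phi i phi -> Phi i psi ->
  Phi i (fun j x => (phi j x + psi j x) / 2).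

Let e (f : X -> R) (x : X) := expR (- (f x / 2)).

Let me (f : X -> R) : measurable_fun setT f -> measurable_fun setT (e f).
Proof.
move=> mf; apply: (measurableT_comp (@measurable_expR R)).
apply: measurable_funN.
by apply: measurable_funM.
Qed.

Let e_bnd (f : X -> R) x : 0 <= f x -> 0 < e f x <= 1.
Proof.
by move=> f0; rewrite expR_gt0/= -expR0 ler_expR oppr_le0 divr_ge0.
Qed.

(** The parallelogram identity, since the square of [e ((f + g) / 2)] is
    [e f * e g]. *)
Let e_sqr (f g : X -> R) x : (e f x - e g x) ^+ 2 +
  2 * (e (fun x => (f x + g x) / 2) x) ^+ 2 = e f x ^+ 2 + e g x ^+ 2.
Proof.
have -> : e (fun x => (f x + g x) / 2) x ^+ 2 = e f x * e g x.
  by rewrite /e -expRD expr2 -expRD; congr expR; field.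
ring.
Qed.

Section fixed_weight.
Variable w : X -> R.
Hypotheses (mw : measurable_fun setT w) (w0 : forall x, 0 < w x)
  (iw : (\int[mu]_x (w x)%:E <= 1%:E)%E).

Let V (phi : J -> X -> R) := (\int[mu]_x (w x * \sum_j e (phi j) x ^+ 2)%:E)%E.

Let mV (phi : J -> X -> R) : (forall j, measurable_fun setT (phi j)) ->
  measurable_fun setT (fun x => w x * \sum_j e (phi j) x ^+ 2).
Proof.
move=> mphi; apply: measurable_funM => //; apply: measurable_sum => j.
by apply: measurable_funX; exact: me.
Qed.

Let V0 (phi : J -> X -> R) x : 0 <= w x * \sum_j e (phi j) x ^+ 2.
Proof. by apply: mulr_ge0; [exact: ltW|apply: sumr_ge0 => j _; exact: sqr_ge0]. Qed.

Let V_le i phi : Phi i phi -> (V phi <= #|J|%:R%:E)%E.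
Proof.
move=> Pphi.
apply: (@le_trans _ _ (\int[mu]_x (#|J|%:R * w x)%:E)%E).
  apply: le_integral_fin => //.
  - by apply: mV; exact: Phi_measurable Pphi.
  - exact: measurable_funM.
  - move=> x; rewrite mulrC; apply: ler_wpM2r; first exact: ltW.
    rewrite -sum1_card natr_sum; apply: ler_sum => j _.
    have /andP[e0 e1] := e_bnd (Phi_ge0 Pphi j x).
    by rewrite exprn_ile1// ltW.
rewrite integralZl_fin//; last by move=> x; exact: ltW.
by rewrite -[leRHS]mule1; apply: lee_wpmul2l.
Qed.

Let Vfin i phi : Phi i phi -> V phi \is a fin_num.
Proof.
move=> /V_le Vle; rewrite ge0_fin_numE; last exact: integral_fin_ge0.
by apply: le_lt_trans Vle _; rewrite ltry.
Qed.

Let v phi : R := fine (V phi).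

Let v0 phi : 0 <= v phi.
Proof. by rewrite fine_ge0//; exact: integral_fin_ge0. Qed.

Let m i := inf (v @` Phi i).

Let has_inf_v i : has_inf (v @` Phi i).
Proof.
split; first by have [phi Pphi] := Phi_nonempty i; exists (v phi), phi.
by exists 0 => _ [phi _ <-].
Qed.

Let m_le i phi : Phi i phi -> m i <= v phi.
Proof.
by move=> Pphi; apply: ge_inf; [have [] := has_inf_v i|exists phi].
Qed.

Let m_mono i k : Phi k `<=` Phi i -> m i <= m k.
Proof.
move=> ki; apply: lb_le_inf; first by have [] := has_inf_v k.
by move=> _ [phi /ki Pphi <-]; exact: m_le.
Qed.

Let m_ub i : m i <= #|J|%:R.
Proof.
have [phi Pphi] := Phi_nonempty i; apply: le_trans (m_le Pphi) _.
by rewrite -lee_fin fineK ?(V_le Pphi)//; exact: Vfin Pphi.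
Qed.

(** Two members of [Phi k] that both almost attain the infimum of [V] over
    [Phi k] are close, because their midpoint cannot do better than that
    infimum. *)
Let parallelogram k (s t : R) phi psi : Phi k phi -> Phi k psi ->
  s - t <= m k -> v phi <= s + t -> v psi <= s + t ->
  forall j, (\int[mu]_x (w x * (e (phi j) x - e (psi j) x) ^+ 2)%:E <= (4 * t)%:E)%E.
Proof.
move=> Pphi Ppsi sm vphi vpsi j.
have mphi := Phi_measurable Pphi; have mpsi := Phi_measurable Ppsi.
set D := fun x => w x * \sum_j (e (phi j) x - e (psi j) x) ^+ 2.
have D0 x : 0 <= D x.
  by apply: mulr_ge0; [exact: ltW|apply: sumr_ge0 => i _; exact: sqr_ge0].
have mD : measurable_fun setT D.
  apply: measurable_funM => //; apply: measurable_sum => i.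
  by apply: measurable_funX; apply: measurable_funB; exact: me.
apply: (@le_trans _ _ (\int[mu]_x (D x)%:E)%E).
  apply: le_integral_fin => //.
  - by apply: measurable_funM => //; apply: measurable_funX;
      apply: measurable_funB; exact: me.
  - by move=> x; apply: mulr_ge0; [exact: ltW|exact: sqr_ge0].
  - move=> x; apply: ler_wpM2l; first exact: ltW.
    rewrite (bigD1 j)//= lerDl; apply: sumr_ge0 => i _; exact: sqr_ge0.
set chi := fun j x => (phi j x + psi j x) / 2.
have Pchi : Phi k chi by exact: Phi_midpoint.
have mchi := Phi_measurable Pchi.
have E : ((\int[mu]_x (D x)%:E) + 2%:E * V chi = V phi + V psi)%E.
  have V2 x : 0 <= 2 * (w x * \sum_j e (chi j) x ^+ 2) by apply: mulr_ge0.
  have mV2 : measurable_fun setT (fun x => 2 * (w x * \sum_j e (chi j) x ^+ 2)).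
    by apply: measurable_funM => //; exact: mV.
  rewrite /V -integralZl_fin//; last exact: mV.
  rewrite -integralD_fin// -integralD_fin//; [|exact: mV|exact: mV].
  apply: eq_integral => x _; congr EFin.
  rewrite /D mulrCA -!mulrDr; congr (_ * _).
  rewrite mulr_sumr -!big_split/=; apply: eq_bigr => i _; exact: e_sqr.
have Dfin : (\int[mu]_x (D x)%:E)%E \is a fin_num.
  rewrite ge0_fin_numE; last exact: integral_fin_ge0.
  apply: (@le_lt_trans _ _ (V phi + V psi)%E).
    by rewrite -E leeDl// mule_ge0//; exact: integral_fin_ge0.
  by apply: lte_add_pinfty; rewrite -ge0_fin_numE ?(Vfin Pphi) ?(Vfin Ppsi)//;
    exact: integral_fin_ge0.
move: E; rewrite -(fineK Dfin) -(fineK (Vfin Pchi)) -(fineK (Vfin Pphi)).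
rewrite -(fineK (Vfin Ppsi)) -EFinM -!EFinD lee_fin => -[].
rewrite -/(v chi) -/(v phi) -/(v psi); move: (m_le Pchi) sm vphi vpsi.
move: (fine _) (v chi) (v phi) (v psi) (m k) => D0i c a b l; lra.
Qed.

Lemma convex_compactness_weighted (i0 : I) : exists g : J -> X -> R,
  (forall j, measurable_fun setT (g j)) /\
  forall i, exists phi : nat -> J -> X -> R, (forall n, Phi i (phi n)) /\
    {ae mu, forall x j, expR (- (phi n j x / 2)) @[n --> \oo] --> g j x}.
Proof.
(* The supremum s of the minima is approached along K n, with tolerance ep n. *)
have hs : has_sup (range m).
  by split; [exists (m i0), i0|exists #|J|%:R => _ [i _ <-]].
pose s := sup (range m).
pose ep n : R := (8 ^ n)%:R^-1.
have ep0 n : 0 < ep n by rewrite invr_gt0 ltr0n expn_gt0.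
have /choice[i_ i_P] n : exists i, s - ep n < m i.
  by have [_ [i _ <-] ?] := sup_adherent (ep0 n) hs; exists i.
have /choice[dir dirP] ik : exists l, Phi l `<=` Phi ik.1 `&` Phi ik.2.
  exact: Phi_directed.
pose K := fix K n := if n is n'.+1 then dir (K n', i_ n'.+1) else i_ 0%N.
have mK n : s - ep n <= m (K n).
  apply: (le_trans (ltW (i_P n))); case: n => [//|n].
  by apply: m_mono => phi /dirP[].
have KS n : Phi (K n.+1) `<=` Phi (K n) by move=> phi /dirP[].
have near_min i n : exists phi, Phi i phi /\ v phi <= s + ep n.
  have [_ [phi Pphi <-] lt] := inf_adherent (ep0 n) (has_inf_v i).
  exists phi; split => //; apply/ltW/(lt_le_trans lt).
  by rewrite lerD2r; apply: sup_upper_bound => //; exists i.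
have /choice[f fP] n : exists phi, Phi (K n) phi /\ v phi <= s + ep n.
  exact: near_min.
have ep_mono n : ep n.+1 <= ep n.
  by rewrite lef_pV2 ?posrE ?ltr0n ?expn_gt0// ler_nat leq_exp2l.
have mf n j : measurable_fun setT (f n j) by exact: Phi_measurable (fP n).1 j.
have cvgf j : {ae mu, forall x, cvgn (fun n => e (f n j) x)}.
  have := @ae_summable_sqr _ X R mu w (fun n x => e (f n.+1 j) x - e (f n j) x)
    mw w0 iw.
  have h n : measurable_fun setT (fun x => e (f n.+1 j) x - e (f n j) x).
    by apply: measurable_funB; exact: me.
  move=> /(_ h); have [fn vn] := (fun n => (fP n).1, fun n => (fP n).2).
  move=> H; have {H} := H (fun n => parallelogram (KS n _ (fn n.+1)) (fn n)
    (mK n) (le_trans (vn n.+1) (lerD (lexx s) (ep_mono n))) (vn n) j).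
  apply: filterS => x /normed_cvg.
  rewrite -/(telescope (fun n => e (f n j) x)) telescopeK => h'.
  have -> : (fun n => e (f n j) x) =
    (fun n => (e (f n j) x - e (f 0%N j) x) + e (f 0%N j) x).
    by apply/funext => n; rewrite subrK.
  by apply: is_cvgD => //; exact: is_cvg_cst.
pose g j x := fine (limn_esup (fun n => (e (f n j) x)%:E)).
have cvgg : {ae mu, forall x j, e (f n j) x @[n --> \oo] --> g j x}.
  apply: filter_forall => j; apply: filterS (cvgf j) => x.
  set u := (fun n => _) => cu.
  have cuE : (fun n => (u n)%:E) @ \oo --> (limn u)%:E by apply: cvg_EFin; [exact: nearW|exact: cu].
  by rewrite /g (cvg_limn_einf_sup cuE).2.
exists g; split.
  move=> j; apply: measurableT_comp => //; apply: measurable_fun_limn_esup => n.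
  by apply/measurable_EFinP; exact: me.
move=> i.
(* The members h n of Phi i are taken also in Phi (K n), where the near
   minimizers f n already live, so that h n and f n have the same limit. *)
have /choice[h hP] n : exists phi, [/\ Phi i phi, Phi (K n) phi & v phi <= s + ep n].
  have [phi [/dirP[Pi PK] vphi]] := near_min (dir (i, K n)) n.
  by exists phi.
exists h; split; first by move=> n; have [] := hP n.
have close : {ae mu, forall x j,
    cvgn [normed series (fun n => e (h n j) x - e (f n j) x)]}.
  apply: filter_forall => j.
  have H n : measurable_fun setT (fun x => e (h n j) x - e (f n j) x).
    apply: measurable_funB; apply: me => //.
    by have [Pi _ _] := hP n; exact: Phi_measurable Pi j.
  have H' n : (\int[mu]_x (w x * (e (h n j) x - e (f n j) x) ^+ 2)%:E <= (4 * ep n)%:E)%E.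
    have [_ PK vh] := hP n; have [fn vn] := fP n.
    exact: parallelogram PK fn (mK n) vh vn j.
  have := ae_summable_sqr mw w0 iw H H'; exact.
apply: filterS2 cvgg close => x fg hf j.
have /normed_cvg/cvg_series_cvg_0 := hf j.
have := fg j; move=> /cvgD /[apply]; rewrite addr0.
have -> // : (fun n => e (f n j) x) + (fun n => e (h n j) x - e (f n j) x) =
  (fun n => e (h n j) x).
by apply/funext => n; rewrite -[LHS]/(e (f n j) x + (e (h n j) x - e (f n j) x)) subrKC.
Qed.

End fixed_weight.

(** The same limit [g] serves every set of the family: this is what allows an
    uncountable family, for which no diagonal sequence is available. *)
Lemma convex_compactness (i0 : I) : exists g : J -> X -> R,
  (forall j, measurable_fun setT (g j)) /\
  forall i, exists phi : nat -> J -> X -> R, (forall n, Phi i (phi n)) /\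
    {ae mu, forall x j, expR (- (phi n j x / 2)) @[n --> \oo] --> g j x}.
Proof.
have [w [mw w0 iw]] := sigma_finite_weight mu.
exact: convex_compactness_weighted mw w0 iw i0.
Qed.

End convex_compactness.

(** * Weights from near maximizers of an integrated geometric mean *)

Lemma powR_sum (R : realType) (J : finType) (a : R) (f : J -> R) : 0 < a ->
  a `^ (\sum_j f j) = \prod_j a `^ f j.
Proof.
by move=> a0; rewrite /powR gt_eqF// mulr_suml expR_sum.
Qed.

(** A first-order lower bound with a uniform error.  With
    [z = 1 - t + t * v / u] it follows from
    [z ^ th >= 1 + th ln z >= 1 + th (1 - 1 / z)] and from [1 - t <= z <= 1 + t L];
    unlike the derivative at [t = 0], it tolerates that [u] is only almost
    optimal. *)
Lemma powR_segment_ge (R : realType) (u v th t L : R) :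
  0 < u -> 0 <= v <= L * u -> 0 < th -> 0 < t < 1 ->
  u `^ th * (1 + th * t * ((v / u) / (1 + t * L) - (1 - t)^-1)) <=
  ((1 - t) * u + t * v) `^ th.
Proof.
move=> u0 /andP[v0 vL] th0 /andP[t0 t1].
have un0 : u != 0 by rewrite gt_eqF.
pose y := v / u.
have y0 : 0 <= y by rewrite divr_ge0// ltW.
have yL : y <= L by rewrite ler_pdivrMr.
have L0 : 0 <= L by rewrite (le_trans y0).
have ty : t * y <= t * L by rewrite ler_wpM2l// ltW.
have ty0 : 0 <= t * y by rewrite mulr_ge0// ltW.
pose z := 1 - t + t * y.
have z1 : 1 - t <= z by rewrite /z lerDl.
have z0 : 0 < z by apply: lt_le_trans z1; rewrite subr_gt0.
have -> : (1 - t) * u + t * v = u * z by rewrite /z /y; field.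
rewrite powRM ?(ltW u0) ?(ltW z0)// ler_pM2l ?powR_gt0//.
rewrite /powR gt_eqF//; apply: le_trans (expR_ge1Dx _).
rewrite lerD2l -mulrA ler_pM2l//.
have lnz : 1 - z^-1 <= ln z.
  have h : -1 < z^-1 - 1 by rewrite ltrBrDr addNr invr_gt0.
  have := le_ln1Dx h; rewrite addrC subrK lnV ?posrE// => h'; lra.
apply: le_trans lnz.
have -> : 1 - z^-1 = t * (y / z - z^-1) by rewrite /z; field; rewrite -/z gt_eqF.
rewrite ler_pM2l// -/y lerB//.
  rewrite ler_wpM2l// lef_pV2 ?posrE//; first by rewrite /z; lra.
  by rewrite ltr_pwDl// mulr_ge0// ltW.
by rewrite lef_pV2 ?posrE// subr_gt0.
Qed.

(** The left-hand side is [1 + 4 e] up to second order, while [1 / K = 8 e]. *)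
Lemma near_maximizer_slack (R : realType) (K e : R) :
  1 <= K -> e = (8 * K)^-1 ->
  (1 + e) * (e + (1 - e)^-1) / (1 - e) <= 1 + K^-1.
Proof.
move=> K1 eE; have K0 : 0 < K by lra.
have -> : K^-1 = 8 * e by rewrite eE; field; rewrite gt_eqF.
have e0 : 0 < e by rewrite eE invr_gt0; lra.
have e8 : e <= 8^-1 by rewrite eE lef_pV2 ?posrE; lra.
have e1 : 0 < 1 - e by lra.
rewrite ler_pdivrMr//.
have -> : (1 + e) * (e + (1 - e)^-1) = ((1 + e) * (e * (1 - e) + 1)) / (1 - e).
  by field; rewrite gt_eqF.
rewrite ler_pdivrMr// -subr_ge0.
have -> : (1 + 8 * e) * (1 - e) * (1 - e) - (1 + e) * (e * (1 - e) + 1) =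
  e * (4 - 15 * e + 9 * (e * e)) by ring.
apply: mulr_ge0; first exact: ltW.
have : 0 <= e * e by rewrite mulr_ge0 ?ltW.
lra.
Qed.

Section near_maximizer.
Context d (X : measurableType d) (R : realType).
Variable mu : {measure set X -> \bar R}.
Variables (J : finType) (theta : J -> R) (C : J -> set (X -> R)).
Hypotheses (theta0 : forall j, 0 < theta j) (theta1 : \sum_j theta j = 1).
Hypothesis C_measurable : forall j u, C j u -> measurable_fun setT u.
Hypothesis C_ge0 : forall j u, C j u -> forall x, 0 <= u x.
Hypothesis C_convex : forall j u v t, 0 <= t <= 1 -> C j u -> C j v ->
  C j (fun x => (1 - t) * u x + t * v x).

Definition geomean (u : J -> X -> R) x := \prod_j u j x `^ theta j.

Lemma geomean_ge0 u x : 0 <= geomean u x.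
Proof. by apply: prodr_ge0 => j _; exact: powR_ge0. Qed.

Lemma measurable_geomean u : (forall j, measurable_fun setT (u j)) ->
  measurable_fun setT (geomean u).
Proof.
move=> mu_; apply: measurable_prod => j _.
exact: (measurableT_comp (measurable_powR (theta j))).
Qed.

(** The weights dual to [u] are [geomean u / u j].  Their geometric mean is
    [1] because the exponents [theta j] have sum [1]. *)
Lemma geomean_dual u x : (forall j, 0 < u j x) ->
  \prod_j (geomean u x / u j x) `^ theta j = 1.
Proof.
move=> u0; have P0 : 0 < geomean u x.
  by apply: prodr_gt0 => j _; exact: powR_gt0.
under eq_bigr do rewrite powRM ?invr_ge0 ?(ltW P0) ?(ltW (u0 _))//.
rewrite big_split/=.
under [X in _ * X]eq_bigr do rewrite -powR_inv1 ?(ltW (u0 _))// -powRrM mulN1r powRN.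
rewrite prodfV -/(geomean u x).
by rewrite -powR_sum// theta1 powRr1 ?(ltW P0)// divff// gt_eqF.
Qed.

Definition replace_at (u : J -> X -> R) j (v : X -> R) k := if k == j then v else u k.

Lemma geomean_replace_at u j v x :
  geomean (replace_at u j v) x = v x `^ theta j * \prod_(k | k != j) u k x `^ theta k.
Proof.
rewrite /geomean (bigD1 j)//= /replace_at eqxx; congr (_ * _).
by apply: eq_bigr => k /negbTE ->.
Qed.

Hypothesis C_bound : forall u, (forall j, C j (u j)) ->
  (\int[mu]_x (geomean u x)%:E <= 1%:E)%E.

(** The functional [G u = \int geomean u] is almost maximized by some [u]
    among the tuples [(1 - e) a + e c] with [a] in the product of the [C j], and
    the weights are those dual to [u].  Moving the [j]-th entry of [u] a little
    towards [v' = (1 - e) v + e c j] cannot increase [G] by more than the defect of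
    [u], which bounds [\int v' phi j], hence [\int v phi j].  The share [e c] keeps
    [u] positive wherever [c] is, and makes [v' / u j] bounded when [v <= K c j], so
    that the error of the first-order expansion is uniform in [v]. *)
Lemma near_maximizer (c : J -> X -> R) (K : R) :
  (forall j, C j (c j)) -> 1 <= K -> exists phi : J -> X -> R,
  [/\ forall j, measurable_fun setT (phi j), forall j x, 0 <= phi j x,
      forall x, (forall j, 0 < c j x) -> 1 <= \prod_j phi j x `^ theta j &
      forall j v, C j v -> (forall x, v x <= K * c j x) ->
        (\int[mu]_x (v x * phi j x)%:E <= (1 + K^-1)%:E)%E].
Proof.
move=> Cc K1.
have K0 : 0 < K by lra.
pose e : R := (8 * K)^-1.
have e0 : 0 < e by rewrite invr_gt0; lra.
have e8 : e <= 8^-1 by rewrite lef_pV2 ?posrE; lra.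
have e01 : 0 <= e <= 1 by lra.
(* L bounds v' / u j; the step t makes both t and t * L at most e. *)
pose L := (K + 1) / e.
have L0 : 0 < L by rewrite divr_gt0//; lra.
pose t := e / (1 + L).
have t0 : 0 < t by rewrite divr_gt0//; lra.
have te : t <= e by rewrite ler_pdivrMr ?ler_peMr//; lra.
have t1 : 0 < 1 - t by lra.
have tL : t * L <= e.
  rewrite /t mulrAC ler_pdivrMr; last lra.
  by apply: ler_wpM2l; [exact: ltW|lra].
pose th := \prod_j theta j.
have th0 : 0 < th by apply: prodr_gt0.
have thle j : th <= theta j.
  rewrite /th (bigD1 j)//=; apply: ler_piMr; first exact: ltW.
  apply: prodr_ile1 => k _.
  rewrite ltW//= -theta1 (bigD1 k)//= lerDl; apply: sumr_ge0 => i _; exact: ltW.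
pose U : set (J -> X -> R) := [set u | exists2 a, (forall j, C j (a j)) &
  u = fun j x => (1 - e) * a j x + e * c j x].
have UC u : U u -> forall j, C j (u j).
  by move=> [a Ca ->] j; exact: C_convex.
pose G u : R := fine (\int[mu]_x (geomean u x)%:E)%E.
have GE u : U u -> (\int[mu]_x (geomean u x)%:E = (G u)%:E)%E.
  move=> Uu; rewrite /G fineK// ge0_fin_numE; last exact/integral_fin_ge0/geomean_ge0.
  by apply: le_lt_trans (C_bound (UC u Uu)) _; rewrite ltry.
have G1 u : U u -> G u <= 1.
  by move=> Uu; rewrite -lee_fin -GE//; apply: C_bound; exact: UC.
have hsG : has_sup (G @` U).
  split; last by exists 1 => _ [u Uu <-]; exact: G1.
  by exists (G (fun j x => (1 - e) * c j x + e * c j x)); apply: imageP; exists c.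
(* The tolerance th * t ^ 2 is of second order in the step t, and th is a
   common lower bound of the exponents. *)
have [_ [u Uu <-] Gu] := sup_adherent (mulr_gt0 th0 (mulr_gt0 t0 t0)) hsG.
have Gsup w : U w -> G w <= sup (G @` U).
  by move=> Uw; apply: sup_upper_bound => //; exact: imageP.
have Cu := UC u Uu.
have mu_ j : measurable_fun setT (u j) by exact: C_measurable (Cu j).
have u0 j x : 0 <= u j x by exact: C_ge0 (Cu j) x.
have uc j x : e * c j x <= u j x.
  have [a Ca ->] := Uu; rewrite lerDr mulr_ge0 ?(C_ge0 (Ca j))//; lra.
have c0 j x : 0 <= c j x by exact: C_ge0 (Cc j) x.
pose phi j x := geomean u x / u j x.
have mphi j : measurable_fun setT (phi j).
  apply: measurable_funM; first exact: measurable_geomean.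
  have -> : (fun x => (u j x)^-1) = (fun x => u j x `^ (-1)).
    by apply/funext => x; rewrite powR_inv1.
  exact: (measurableT_comp (measurable_powR (-1))).
have phi0 j x : 0 <= phi j x by rewrite divr_ge0// geomean_ge0.
exists phi; split => //.
  move=> x cx; rewrite geomean_dual// => j.
  by apply: lt_le_trans (uc j x); rewrite mulr_gt0.
move=> j v Cv vK.
have v0 x : 0 <= v x by exact: C_ge0 Cv x.
have mv := C_measurable Cv.
pose v' x := (1 - e) * v x + e * c j x.
have Cv' : C j v' by exact: C_convex.
have v'0 x : 0 <= v' x by exact: C_ge0 Cv' x.
have mv' := C_measurable Cv'.
have v'L x : v' x <= L * u j x.
  apply: (@le_trans _ _ (L * (e * c j x))); last by rewrite ler_pM2l.
  rewrite /L mulrA divfK ?gt_eqF// mulrDl mul1r lerD//.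
    by apply: le_trans (vK x); rewrite ler_piMl//; lra.
  by rewrite ler_piMl//; lra.
pose u' := replace_at u j (fun x => (1 - t) * u j x + t * v' x).
have Uu' : U u'.
  have [a Ca uE] := Uu.
  exists (replace_at a j (fun x => (1 - t) * a j x + t * v x)).
    move=> k; rewrite /replace_at; case: eqP => [->|_//]; apply: C_convex => //; lra.
  apply/funext => k; apply/funext => x; rewrite /u' /replace_at uE; case: eqP => [->|//].
  by rewrite /v'; ring.
have key x : geomean u x + theta j * t / (1 + t * L) * (v' x * phi j x) <=
    geomean u' x + theta j * t / (1 - t) * geomean u x.
  have coef : 0 <= theta j * t / (1 - t).
    by apply: divr_ge0; [apply: mulr_ge0|]; exact: ltW.
  have [uj0|ujn0] := eqVneq (u j x) 0.
    have v'x : v' x = 0.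
      by apply/eqP; rewrite eq_le v'0 andbT -[leRHS](mulr0 L) -uj0.
    have -> : geomean u x = 0.
      by rewrite /geomean (bigD1 j)//= uj0 powR0 ?mul0r// gt_eqF.
    by rewrite v'x mul0r !mulr0 !addr0 geomean_ge0.
  have ujx : 0 < u j x by rewrite lt_neqAle eq_sym ujn0 u0.
  have := @powR_segment_ge R (u j x) (v' x) (theta j) t L ujx.
  rewrite v'0 v'L t0 (le_lt_trans te)/=; last by lra.
  move=> /(_ isT (theta0 j) isT) h.
  rewrite -subr_ge0 geomean_replace_at /phi.
  have -> : geomean u x = u j x `^ theta j * \prod_(k | k != j) u k x `^ theta k.
    by rewrite /geomean (bigD1 j).
  set Q := \prod_(k | _) _.
  have Q0 : 0 <= Q by apply: prodr_ge0 => k _; exact: powR_ge0.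
  move: h; rewrite -subr_ge0 => h; apply: le_trans (mulr_ge0 h Q0) _.
  by rewrite le_eqVlt; apply/orP; left; apply/eqP; ring.
have ge1 x := geomean_ge0 u x.
have mgu : measurable_fun setT (geomean u) by exact: measurable_geomean.
have mgu' : measurable_fun setT (geomean u').
  by apply: measurable_geomean => k; exact: C_measurable (UC _ Uu' k).
have vphi0 x : 0 <= v' x * phi j x by rewrite mulr_ge0.
have mvphi : measurable_fun setT (fun x => v' x * phi j x) by exact: measurable_funM.
have tL1 : 0 < 1 + t * L by have := mulr_gt0 t0 L0; lra.
have a0 : 0 < theta j * t / (1 + t * L).
  by apply: divr_gt0 => //; exact: mulr_gt0.
have b0 : 0 <= theta j * t / (1 - t).
  by apply: divr_ge0; [apply: mulr_ge0|]; exact: ltW.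
have I1 : ((G u)%:E + (theta j * t / (1 + t * L))%:E * \int[mu]_x (v' x * phi j x)%:E <=
    (G u')%:E + (theta j * t / (1 - t))%:E * (G u)%:E)%E.
  rewrite -(GE _ Uu) -(GE _ Uu') -!integralZl_fin//; [|exact: ltW].
  rewrite -!integralD_fin//.
  - apply: le_integral_fin => //.
    + by apply: measurable_funD => //; exact: measurable_funM.
    + by apply: measurable_funD => //; exact: measurable_funM.
    + by move=> x; rewrite addr_ge0// mulr_ge0// ltW.
  - exact: measurable_funM.
  - by move=> x; exact: geomean_ge0.
  - by move=> x; rewrite mulr_ge0.
  - exact: measurable_funM.
  - by move=> x; rewrite mulr_ge0// ltW.
have I2 : (\int[mu]_x (v' x * phi j x)%:E <= ((1 + t * L) * (t + (1 - t)^-1))%:E)%E.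
  move: I1; case: (\int[mu]_x _)%E (integral_fin_ge0 mu vphi0) => [r|_|//].
    rewrite lee_fin => r0; rewrite -!EFinM -!EFinD !lee_fin => h.
    have h1 := Gsup _ Uu'; have h2 := G1 _ Uu.
    have tj : 0 < theta j * t by rewrite mulr_gt0.
    have h3 : th * (t * t) <= theta j * (t * t) by rewrite ler_wpM2r ?thle// mulr_ge0 ?ltW.
    have h4 : theta j * t * (r / (1 + t * L)) <= theta j * t * (t + (1 - t)^-1).
      rewrite mulrDr.
      have h5 : theta j * t / (1 - t) * G u <= theta j * t / (1 - t).
        by rewrite ler_piMr.
      rewrite mulrA [theta j * t * r / _]mulrAC; lra.
    move: h4; rewrite ler_pM2l// ler_pdivrMr// mulrC; exact.
  by rewrite gt0_muley ?lte_fin// addey// -EFinM -EFinD leye_eq.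
have e1 : 0 < 1 - e by lra.
apply: (@le_trans _ _ ((1 - e)^-1%:E * \int[mu]_x (v' x * phi j x)%:E)%E).
  rewrite -integralZl_fin//; last by rewrite invr_ge0 ltW.
  apply: le_integral_fin.
  - exact: measurable_funM.
  - exact: measurable_funM.
  - by move=> x; rewrite mulr_ge0.
  - move=> x; rewrite [leRHS]mulrA; apply: ler_wpM2r => //.
    rewrite ler_pdivlMl// /v' lerDl.
    by rewrite mulr_ge0// ltW.
apply: (@le_trans _ _ ((1 - e)^-1%:E * ((1 + t * L) * (t + (1 - t)^-1))%:E)%E).
  by apply: lee_wpmul2l => //; rewrite lee_fin invr_ge0 ltW.
rewrite -EFinM lee_fin; apply: le_trans (near_maximizer_slack K1 (erefl e)).
rewrite mulrC ler_wpM2r ?invr_ge0 ?(ltW e1)//.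
have i0 : 0 < (1 - t)^-1 by rewrite invr_gt0; lra.
have i1 : (1 - t)^-1 <= (1 - e)^-1 by rewrite lef_pV2 ?posrE; lra.
have tL0 := mulr_gt0 t0 L0.
by apply: ler_pM; lra.
Qed.

End near_maximizer.

(** * Limits of powers and logarithms, and Fatou's lemma *)

Section limits.
Context (R : realType).

(** Continuity of [powR] in its base comes from that of [exp] and [ln] at a
    positive limit, and from monotonicity at the limit [0]. *)
Lemma cvg_powR (u : nat -> R) (l th : R) : (forall n, 0 <= u n) -> 0 < th ->
  u n @[n --> \oo] --> l -> u n `^ th @[n --> \oo] --> l `^ th.
Proof.
move=> u0 th0 ul.
have l0 : 0 <= l by rewrite -(cvg_lim _ ul)//; apply: limr_ge; [exact: cvgP ul|exact: nearW].
have [ln0|ln0] := eqVneq l 0.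
  rewrite ln0 powR0 ?gt_eqF//; apply/cvgr0Pnorm_lt => e e0.
  have e'0 : 0 < e `^ th^-1 by exact: powR_gt0.
  have : \forall n \near \oo, u n < e `^ th^-1.
    by rewrite ln0 in ul; exact: cvgr_lt ul _ e'0.
  apply: filterS => n une; rewrite ger0_norm ?powR_ge0//.
  have -> : e = (e `^ th^-1) `^ th.
    by rewrite -powRrM mulVf ?gt_eqF// powRr1// ltW.
  by rewrite gt0_ltr_powR// nnegrE// ltW.
have {ln0}l0 : 0 < l by rewrite lt_neqAle eq_sym ln0.
have lnl : ln (u n) @[n --> \oo] --> ln l by apply: continuous_cvg ul; exact: continuous_ln.
have : expR (th * ln (u n)) @[n --> \oo] --> expR (th * ln l).
  apply: continuous_cvg; first exact: continuous_expR.
  by apply: cvgM => //; exact: cvg_cst.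
rewrite [l `^ _]/powR gt_eqF//; apply: cvg_trans; apply: near_eq_cvg.
have : \forall n \near \oo, 0 < u n by exact: cvgr_gt ul _ l0.
by apply: filterS => n un0; rewrite /powR gt_eqF.
Qed.

Lemma cvg_prod (J : finType) (f : nat -> J -> R) (l : J -> R) :
  (forall j, f n j @[n --> \oo] --> l j) ->
  \prod_j f n j @[n --> \oo] --> \prod_j l j.
Proof.
by move=> fl; apply: (cvg_big (@mul_continuous R)) => j _; exact: fl.
Qed.

Lemma cvg_of_expRN (a : nat -> R) (g : R) : 0 < g ->
  expR (- (a n / 2)) @[n --> \oo] --> g -> a n @[n --> \oo] --> - (2 * ln g).
Proof.
move=> g0 /(continuous_cvg _ (continuous_ln g0)) /=.
move=> /(cvgM (cvg_cst (2 : R)))/cvgN.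
apply: cvg_trans; apply: near_eq_cvg; apply: nearW => n.
by rewrite -[LHS]/(- (2 * ln (expR (- (a n / 2))))) expRK; field.
Qed.

Lemma cvgy_of_expRN (a : nat -> R) :
  expR (- (a n / 2)) @[n --> \oo] --> (0 : R) -> (a n)%:E @[n --> \oo] --> +oo%E.
Proof.
move=> a0; apply/cvgeyPge => M.
have : \forall n \near \oo, expR (- (a n / 2)) < expR (- (M / 2)).
  by apply: (cvgr_lt _ a0); exact: expR_gt0.
by apply: filterS => n; rewrite ltr_expR lee_fin; lra.
Qed.

End limits.

Section fatou.
Context d (X : measurableType d) (R : realType).
Variable mu : {measure set X -> \bar R}.

Lemma limn_einf_le (u : nat -> \bar R) (B : \bar R) : (forall n, (u n <= B)%E) ->
  (limn_einf u <= B)%E.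
Proof.
move=> uB; apply: le_trans (limn_einf_sup u) _; rewrite limn_esup_lim.
apply: lime_le; first exact: is_cvg_esups.
by apply: nearW => n; apply: ge_ereal_sup => _ [m _ <-].
Qed.

(** The limit is allowed the value [+oo], so that a finite [B] also shows it to
    be finite almost everywhere. *)
Lemma fatou_cvg (f_ : nat -> X -> R) (f : X -> \bar R) (B : \bar R) :
  (forall n, measurable_fun setT (f_ n)) -> (forall n x, 0 <= f_ n x) ->
  measurable_fun setT f -> (forall x, (0 <= f x)%E) ->
  {ae mu, forall x, (f_ n x)%:E @[n --> \oo] --> f x} ->
  (forall n, (\int[mu]_x (f_ n x)%:E <= B)%E) -> (\int[mu]_x f x <= B)%E.
Proof.
move=> mf_ f_0 mf f0 f_f f_B.
pose F x := limn_einf (fun n => (f_ n x)%:E).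
have mF : measurable_fun setT F.
  rewrite /F /limn_einf; apply: measurableT_comp => //.
  apply: measurable_fun_limn_esup => n; apply: measurableT_comp => //.
  exact/measurable_EFinP.
have F0 x : (0 <= F x)%E.
  rewrite /F limn_einf_lim; apply: lime_ge; first exact: is_cvg_einfs.
  by apply: nearW => n; apply: le_ereal_inf_tmp => _ [m _ <-]; rewrite lee_fin.
apply: (@le_trans _ _ (\int[mu]_x F x)%E).
  apply: ae_ge0_le_integral => //.
  by apply: filterS f_f => x h _; rewrite /F (cvg_limn_einf_sup h).1.
apply: le_trans (limn_einf_le f_B); apply: fatou => //.
- by move=> n; exact/measurable_EFinP.
- by move=> n x _; rewrite lee_fin.
Qed.

End fatou.

(** * Factorisation for convex saturating sets *)

Section factorisation.
Context d (X : measurableType d) (R : realType).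
Variable mu : {sigma_finite_measure set X -> \bar R}.
Variables (J : finType) (theta : J -> R) (C : J -> set (X -> R)).
Hypotheses (theta0 : forall j, 0 < theta j) (theta1 : \sum_j theta j = 1).
Hypothesis C_measurable : forall j u, C j u -> measurable_fun setT u.
Hypothesis C_ge0 : forall j u, C j u -> forall x, 0 <= u x.
Hypothesis C_convex : forall j u v t, 0 <= t <= 1 -> C j u -> C j v ->
  C j (fun x => (1 - t) * u x + t * v x).
Hypothesis C_nonempty : forall j, C j !=set0.
Hypothesis C_saturates : forall j E, measurable E -> (0 < mu E)%E ->
  exists E' u, [/\ measurable E', E' `<=` E, (0 < mu E')%E, C j u &
    forall x, E' x -> 0 < u x].

(** Saturation is applied to the indices one after the other, each time inside
    the set produced for the previous ones. *)
Lemma joint_saturation E : measurable E -> (0 < mu E)%E ->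
  exists E' c, [/\ measurable E', E' `<=` E, (0 < mu E')%E,
    forall j, C j (c j) & forall j x, E' x -> 0 < c j x].
Proof.
move=> mE E0.
have : exists E', [/\ measurable E', E' `<=` E, (0 < mu E')%E &
    forall j, j \in enum J -> exists u, C j u /\ forall x, E' x -> 0 < u x].
  elim: (enum J) => [|j s [F [mF FE F0 Fs]]]; first by exists E; split => // j; rewrite in_nil.
  have [F' [u [mF' F'F F'0 Cu u0]]] := C_saturates j mF F0.
  exists F'; split => // [|k]; first exact: subset_trans FE.
  rewrite inE => /predU1P[->|/Fs[v [Cv v0]]]; first by exists u.
  by exists v; split => // x /F'F; exact: v0.
move=> [E' [mE' E'E E'0 h]].
have /choice[c cP] j : exists u, C j u /\ forall x, E' x -> 0 < u x.
  by apply: h; rewrite mem_enum.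
by exists E', c; split => // j; have [] := cP j.
Qed.

Hypothesis C_bound : forall u, (forall j, C j (u j)) ->
  (\int[mu]_x (geomean theta u x)%:E <= 1%:E)%E.

(** The constraints are indexed by a tuple [c] of elements of the [C j] and a
    bound [K].  Only functions dominated by [K c] are tested, up to an error
    [1 / K], and the lower bound on the geometric mean is required only where [c] is
    positive: this is what a near maximizer can offer, and every function and almost
    every point is eventually covered. *)
Let Idx := {ck : (J -> X -> R) * R | (forall j, C j (ck.1 j)) /\ 1 <= ck.2}.

Let Phi (i : Idx) : set (J -> X -> R) := [set phi : J -> X -> R |
  [/\ forall j, measurable_fun setT (phi j), forall j x, 0 <= phi j x,
      forall x, (forall j, 0 < (sval i).1 j x) ->
        1 <= \prod_j phi j x `^ theta j &
      forall j v, C j v -> (forall x, v x <= (sval i).2 * (sval i).1 j x) ->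
        (\int[mu]_x (v x * phi j x)%:E <= (1 + (sval i).2^-1)%:E)%E]].

Let Phi_nonempty i : Phi i !=set0.
Proof.
case: i => -[c K] [Cc K1].
have [phi ?] := near_maximizer theta0 theta1 C_measurable C_ge0 C_convex C_bound Cc K1.
by exists phi.
Qed.

(** The average of [c] and [c'] with the bound [2 (K + K')] imposes all the
    constraints of [(c, K)] and of [(c', K')]. *)
Let Phi_directed i k : exists l, Phi l `<=` Phi i `&` Phi k.
Proof.
case: i k => -[c K] cK [[c' K'] cK'].
have /= [Cc K1] := cK; have /= [Cc' K'1] := cK'.
have half : 0 <= (2^-1 : R) <= 1 by lra.
have c0 j x := C_ge0 (Cc j) x; have c'0 j x := C_ge0 (Cc' j) x.
pose c2 j x := (1 - 2^-1) * c j x + 2^-1 * c' j x.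
have Cc2 : (forall j, C j (c2 j)) /\ 1 <= 2 * (K + K').
  by split; [move=> j; exact: C_convex|lra].
exists (exist _ (c2, 2 * (K + K')) Cc2) => phi [/= mphi phi0 phi1 phiC].
have inv x : 1 <= x -> x <= K + K' -> ((1 + (2 * (K + K'))^-1)%:E <= (1 + x^-1)%:E)%E.
  by move=> x1 xK; rewrite lee_fin lerD2l lef_pV2 ?posrE; lra.
split; split => //=.
- by move=> x cx; apply: phi1 => j; rewrite /c2; have := cx j; have := c'0 j x; lra.
- move=> j v Cv vK; apply: le_trans (inv K K1 _); last by lra.
  apply: phiC => // x; apply: le_trans (vK x) _.
  have -> : 2 * (K + K') * c2 j x = (K + K') * (c j x + c' j x) by rewrite /c2; field.
  by apply: ler_pM => //; have := c0 j x; have := c'0 j x; lra.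
- by move=> x cx; apply: phi1 => j; rewrite /c2; have := cx j; have := c0 j x; lra.
- move=> j v Cv vK; apply: le_trans (inv K' K'1 _); last by lra.
  apply: phiC => // x; apply: le_trans (vK x) _.
  have -> : 2 * (K + K') * c2 j x = (K + K') * (c j x + c' j x) by rewrite /c2; field.
  by apply: ler_pM => //; have := c0 j x; have := c'0 j x; lra.
Qed.

(** The lower bound survives midpoints because the square of the geometric mean
    of [(phi + psi) / 2] is at least the product of those of [phi] and [psi]. *)
Let Phi_midpoint i phi psi : Phi i phi -> Phi i psi ->
  Phi i (fun j x => (phi j x + psi j x) / 2).
Proof.
move=> [mphi phi0 phi1 phiC] [mpsi psi0 psi1 psiC]; split.
- by move=> j; apply: measurable_funM => //; exact: measurable_funD.
- by move=> j x; rewrite divr_ge0// addr_ge0.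
- move=> x cx; set Q := \prod_j _.
  have Q0 : 0 <= Q by apply: prodr_ge0 => j _; exact: powR_ge0.
  rewrite -(@ler_sqr _ 1 Q) ?nnegrE// expr1n.
  have := ler_pM ler01 ler01 (phi1 x cx) (psi1 x cx).
  rewrite mulr1 => /le_trans; apply.
  rewrite /Q -prodrXl -big_split/=; apply: ler_prod => j _.
  rewrite mulr_ge0 ?powR_ge0//= -powRM// expr2 -powRM ?divr_ge0 ?addr_ge0//.
  apply: ge0_ler_powR; rewrite ?nnegrE ?mulr_ge0 ?divr_ge0 ?addr_ge0//.
    exact: ltW.
  rewrite -subr_ge0.
  have -> : (phi j x + psi j x) / 2 * ((phi j x + psi j x) / 2) - phi j x * psi j x =
    ((phi j x - psi j x) / 2) ^+ 2 by field.
  exact: sqr_ge0.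
- move=> j v Cv vK; have v0 := C_ge0 Cv; have mv := C_measurable Cv.
  have -> : (fun x => (v x * ((phi j x + psi j x) / 2))%:E) =
    (fun x => (2^-1 * (v x * phi j x + v x * psi j x))%:E).
    by apply/funext => x; congr EFin; field.
  have m1 : measurable_fun setT (fun x => v x * phi j x) by exact: measurable_funM.
  have m2 : measurable_fun setT (fun x => v x * psi j x) by exact: measurable_funM.
  rewrite integralZl_fin//; [|exact: measurable_funD|by move=> x; rewrite addr_ge0// mulr_ge0].
  rewrite integralD_fin//; [|by move=> x; rewrite mulr_ge0..].
  have := leeD (phiC j v Cv vK) (psiC j v Cv vK).
  move=> /(@lee_wpmul2l _ (2^-1)%:E); rewrite lee_fin invr_ge0 ler0n => /(_ isT).
  move=> /le_trans; apply; rewrite -EFinD -EFinM lee_fin; lra.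
Qed.

(** A common limit [phi] of the constraint sets exists in [[0, +oo]].  Fatou's
    lemma gives [\int v phi j <= 1] for every [v] in [C j]; since such [v] can be
    positive on part of any set of positive measure, [phi j] is finite almost
    everywhere.  The lower bound on the geometric mean then passes to the limit on
    the sets where some tuple [c] is positive, which exhaust the space by joint
    saturation. *)
Lemma factorisation : exists phi : J -> X -> R,
  [/\ forall j, measurable_fun setT (phi j), forall j x, 0 <= phi j x,
      {ae mu, forall x, 1 <= \prod_j phi j x `^ theta j} &
      forall j v, C j v -> (\int[mu]_x (v x * phi j x)%:E <= 1%:E)%E].
Proof.
have /choice[c Cc] := C_nonempty.
have i0P : (forall j, C j (c j)) /\ (1 : R) <= 1 by [].
have [g [mg gP]] := convex_compactness mu Phi_nonempty Phi_directed
  (fun i phi (h : Phi i phi) => let: And4 h1 _ _ _ := h in h1)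
  (fun i phi (h : Phi i phi) => let: And4 _ h2 _ _ := h in h2)
  Phi_midpoint (exist _ (c, 1) i0P).
(* The limit psi is +oo where g vanishes; phi is a finite version of it. *)
pose phi j x := Num.max 0 (- (2 * ln (g j x))).
pose psi j x : \bar R := if 0 < g j x then (phi j x)%:E else +oo%E.
have mphi j : measurable_fun setT (phi j).
  apply: measurable_maxr => //; apply: measurable_funN.
  by apply: measurable_funM => //; exact: (measurableT_comp (@measurable_ln R)).
have phi0 j x : 0 <= phi j x by rewrite le_max lexx.
have psi0 j x : (0 <= psi j x)%E.
  by rewrite /psi; case: ifP => _; rewrite ?lee_fin// leey.
have mpsi j : measurable_fun setT (psi j).
  apply: measurable_fun_ifT => //; first exact: measurable_fun_ltr.
  exact/measurable_EFinP.
have lim (a : nat -> R) (j : J) (x : X) : (forall n, 0 <= a n) ->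
    expR (- (a n / 2)) @[n --> \oo] --> g j x ->
    (a n)%:E @[n --> \oo] --> psi j x.
  move=> a0 ag; rewrite /psi; case: ifPn => [g0|].
    have ap := cvg_of_expRN g0 ag.
    rewrite /phi max_r; first by apply: cvg_EFin; [exact: nearW|exact: ap].
    by rewrite -(cvg_lim _ ap)//; apply: limr_ge; [exact: cvgP ap|exact: nearW].
  rewrite -leNgt => g0; apply: cvgy_of_expRN.
  suff <- : g j x = 0 by [].
  apply/eqP; rewrite eq_le g0 -(cvg_lim _ ag)//=; apply: limr_ge.
    exact: cvgP ag.
  by apply: nearW => n; exact: expR_ge0.
have psi_bound j v : C j v -> (\int[mu]_x ((v x)%:E * psi j x) <= 1%:E)%E.
  move=> Cv; have v0 := C_ge0 Cv; have mv := C_measurable Cv.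
  apply/lee_addgt0Pr => e e0.
  pose K := Num.max 1 e^-1.
  have K1 : 1 <= K by rewrite le_max lexx.
  have iP : (forall k, C k (replace_at c j v k)) /\ 1 <= K.
    by split => // k; rewrite /replace_at; case: eqP => [->|_].
  have [f [fP fg]] := gP (exist _ (replace_at c j v, K) iP).
  apply: (@fatou_cvg _ _ _ mu (fun n x => v x * f n j x)).
  - move=> n; apply: measurable_funM => //; have [h _ _ _] := fP n; exact: h.
  - move=> n x; apply: mulr_ge0 => //; have [_ h _ _] := fP n; exact: h.
  - by apply: emeasurable_funM => //; exact/measurable_EFinP.
  - by move=> x; apply: mule_ge0; rewrite // lee_fin.
  - apply: filterS fg => x fx; under eq_fun do rewrite EFinM.
    apply: cvgeZl => //; apply: lim => // n; have [_ h _ _] := fP n; exact: h.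
  - move=> n; have [_ _ _ /(_ j v Cv)/= h] := fP n.
    apply: le_trans (h _) _.
      by move=> x; rewrite /replace_at eqxx ler_peMl.
    rewrite -EFinD lee_fin lerD2l -[leRHS]invrK lef_pV2 ?posrE ?invr_gt0//.
      by rewrite le_max lexx orbT.
    exact: lt_le_trans K1.
have g_pos j : {ae mu, forall x, 0 < g j x}.
  pose E := [set x | g j x <= 0].
  have mE : measurable E.
    by rewrite -[E]setTI; apply: measurable_fun_le => //.
  suff muE0 : mu E = 0.
    by exists E; split => // x /=; rewrite /E/= leNgt => /negP.
  apply/eqP; rewrite -measure_le0 leNgt; apply/negP => E0.
  have [E' [u [mE' E'E E'0 Cu u0]]] := C_saturates j mE E0.
  have upsi0 x : (0 <= (u x)%:E * psi j x)%E.
    by apply: mule_ge0 => //; rewrite lee_fin; exact: C_ge0 Cu x.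
  have : mu.-integrable setT (fun x => (u x)%:E * psi j x)%E.
    apply/integrableP; split.
      apply: emeasurable_funM => //; apply/measurable_EFinP; exact: C_measurable Cu.
    under eq_integral do rewrite gee0_abs//.
    by apply: le_lt_trans (psi_bound j u Cu) _; rewrite ltry.
  move/(integrable_ae measurableT) => [N [mN muN0 NP]].
  have E'N : E' `<=` N.
    move=> x E'x; apply: NP => /= /(_ I).
    have := E'E x E'x; rewrite /E/= => gx.
    by rewrite /psi ltNge gx/= gt0_muley// lte_fin u0.
  move: E'0; rewrite ltNge => /negP; apply.
  by rewrite -muN0; apply: le_measure; rewrite ?inE.
exists phi; split => //; last first.
  move=> j v Cv; apply: le_trans (psi_bound j v Cv).
  have v0 := C_ge0 Cv; have mv := C_measurable Cv.
  apply: ge0_le_integral => //.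
  - by move=> x _; rewrite lee_fin mulr_ge0.
  - by apply/measurable_EFinP; exact: measurable_funM.
  - by apply: emeasurable_funM => //; exact/measurable_EFinP.
  - move=> x _; rewrite EFinM; apply: lee_wpmul2l; first by rewrite lee_fin.
    by rewrite /psi; case: ifP => _; rewrite ?leey.
pose B := ~` [set x | 1 <= \prod_j phi j x `^ theta j].
have mB : measurable B.
  apply: measurableC; rewrite -[X in measurable X]setTI.
  apply: measurable_fun_le => //; apply: measurable_prod => j _.
  exact: (measurableT_comp (measurable_powR (theta j))).
suff muB0 : mu B = 0 by exists B; split.
apply/eqP; rewrite -measure_le0 leNgt; apply/negP => B0.
have [E' [c' [mE' E'B E'0 Cc' c'0]]] := joint_saturation mB B0.
have iP : (forall j, C j (c' j)) /\ (1 : R) <= 1 by [].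
have [f [fP fg]] := gP (exist _ (c', 1) iP).
have : {ae mu, forall x, E' x -> 1 <= \prod_j phi j x `^ theta j}.
  have gx : {ae mu, forall x j, 0 < g j x} by exact: filter_forall.
  apply: filterS2 fg gx => x fx gx E'x.
  have cv j : f n j x @[n --> \oo] --> phi j x.
    have fp n : 0 <= f n j x by have [_ h _ _] := fP n; exact: h.
    have := lim _ _ _ fp (fx j); rewrite /psi gx.
    by move=> /fine_cvg.
  have := cvg_prod (fun j => cvg_powR (fun n => _) (theta0 j) (cv j)).
  move=> /(_ (fun j n => let: And4 _ h _ _ := fP n in h j x)) => pc.
  rewrite -(cvg_lim _ pc)//; apply: limr_ge; first exact: cvgP pc.
  by apply: nearW => n; have [_ _ h _] := fP n; apply: h => j; exact: c'0.
move=> [N [mN muN0 NP]].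
have E'N : E' `<=` N.
  by move=> x E'x; apply: NP => /= /(_ E'x); exact: E'B E'x.
move: E'0; rewrite ltNge => /negP; apply.
by rewrite -muN0; apply: le_measure; rewrite ?inE.
Qed.

End factorisation.

(** * Weighted power means *)

Section power_means.
Context (R : realType).
Implicit Types (p q t a b x y : R).

Definition pmean q t a b := ((1 - t) * a `^ q + t * b `^ q) `^ q^-1.

Lemma pmean_ge0 q t a b : 0 <= pmean q t a b.
Proof. exact: powR_ge0. Qed.

Lemma powR_convex p t a b : 1 <= p -> 0 <= t <= 1 -> 0 <= a -> 0 <= b ->
  ((1 - t) * a + t * b) `^ p <= (1 - t) * a `^ p + t * b `^ p.
Proof.
move=> p1 /andP[t0 t1] a0 b0.
have s0 : 0 <= 1 - t by rewrite subr_ge0.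
have s1 : 1 - t <= 1 by rewrite gerBl.
have -> : t = 1 - (1 - t) by ring.
have -> : 1 - (1 - (1 - t)) = 1 - t by ring.
by apply: (convex_powR p1 (Itv01 s0 s1));
  rewrite inE/= in_itv/= ?a0 ?b0.
Qed.

Lemma convex_comb_ge0 t a b : 0 <= t <= 1 -> 0 <= a -> 0 <= b -> 0 <= (1 - t) * a + t * b.
Proof. by move=> /andP[t0 t1] a0 b0; rewrite addr_ge0// mulr_ge0// subr_ge0. Qed.

Lemma pmean_powR q t a b : 0 < q -> 0 <= t <= 1 ->
  pmean q t a b `^ q = (1 - t) * a `^ q + t * b `^ q.
Proof.
move=> q0 t01; rewrite /pmean -powRrM mulVf ?gt_eqF// powRr1//.
by apply: convex_comb_ge0 => //; exact: powR_ge0.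
Qed.

Lemma pmean_le_powR p q t a b : 0 < p -> p <= q -> 0 <= t <= 1 ->
  0 <= a -> 0 <= b -> (1 - t) * a `^ p + t * b `^ p <= pmean q t a b `^ p.
Proof.
move=> p0 pq t01 a0 b0.
have q0 : 0 < q by exact: lt_le_trans pq.
set L := (X in X <= _).
have L0 : 0 <= L by apply: convex_comb_ge0 => //; exact: powR_ge0.
have -> : L = (L `^ (q / p)) `^ (p / q).
  rewrite -powRrM -[p / q]invf_div divff ?powRr1//.
  by rewrite mulf_neq0 ?invr_eq0 ?gt_eqF.
rewrite /pmean -[leRHS]powRrM [q^-1 * p]mulrC.
apply: ge0_ler_powR; rewrite ?nnegrE ?powR_ge0 ?divr_ge0 ?(ltW p0) ?(ltW q0)//.
  by apply: convex_comb_ge0 => //; exact: powR_ge0.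
apply: le_trans (powR_convex _ t01 (powR_ge0 _ _) (powR_ge0 _ _)) _.
  by rewrite ler_pdivlMr// mul1r.
by rewrite -!powRrM [p * (q / p)]mulrC divfK ?gt_eqF.
Qed.

Lemma pmean_powR_le q r t a b : 0 < q -> q <= r -> 0 <= t <= 1 ->
  0 <= a -> 0 <= b -> pmean q t a b `^ r <= (1 - t) * a `^ r + t * b `^ r.
Proof.
move=> q0 qr t01 a0 b0.
have -> : pmean q t a b `^ r = ((1 - t) * a `^ q + t * b `^ q) `^ (r / q).
  by rewrite /pmean -[LHS]powRrM [q^-1 * r]mulrC.
apply: le_trans (powR_convex _ t01 (powR_ge0 _ _) (powR_ge0 _ _)) _.
  by rewrite ler_pdivlMr// mul1r.
by rewrite -!powRrM [q * (r / q)]mulrC divfK ?gt_eqF.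
Qed.

Lemma powR_le1 q x : 0 <= q -> 0 <= x <= 1 -> x `^ q <= 1.
Proof.
move=> q0 /andP[x0 x1]; have <- : 1 `^ q = 1 :> R by rewrite powR1.
by apply: ge0_ler_powR; rewrite ?nnegrE.
Qed.

Lemma pmean_le1 q t a b : 0 < q -> 0 <= t <= 1 -> 0 <= a <= 1 -> 0 <= b <= 1 ->
  pmean q t a b <= 1.
Proof.
move=> q0 t01 a01 b01; have /andP[t0 t1] := t01.
apply: powR_le1; first by rewrite invr_ge0 ltW.
rewrite convex_comb_ge0 ?powR_ge0//=.
have := ler_wpM2l t0 (powR_le1 (ltW q0) b01).
have s0 : 0 <= 1 - t by rewrite subr_ge0.
have := ler_wpM2l s0 (powR_le1 (ltW q0) a01).
lra.
Qed.

Lemma young_powR q x y : 1 <= q -> 0 <= x -> 0 <= y ->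
  q * (x `^ (q - 1) * y) <= (q - 1) * x `^ q + y `^ q.
Proof.
move=> q1 x0 y0; have [->|qn1] := eqVneq q 1.
  by rewrite subrr powRr0 mul0r add0r !mul1r powRr1.
have q1' : 0 < q - 1 by rewrite subr_gt0 lt_neqAle eq_sym qn1.
have q0 : 0 < q by lra.
have := @conjugate_powR R y (x `^ (q - 1)) q (q / (q - 1)) y0 (powR_ge0 _ _) q0.
rewrite divr_gt0// invf_div => /(_ isT).
have -> : q^-1 + (q - 1) / q = 1 by field; rewrite gt_eqF.
move=> /(_ erefl); rewrite -powRrM mulrC [(q - 1) * _]mulrC divfK ?gt_eqF// => h.
have := ler_wpM2l (ltW q0) h; move=> /le_trans; apply.
rewrite mulrDr mulrCA divff ?gt_eqF// mulr1.
have -> : q * (x `^ q * ((q - 1) / q)) = (q - 1) * x `^ q.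
  by field; rewrite gt_eqF.
by rewrite addrC.
Qed.

(** The left-hand side is the tangent at [(a1, b1)] of the norm [pmean q t], so
    the inequality is Young's inequality applied to each coordinate after
    normalisation. *)
Lemma pmean_tangent q t a1 b1 a b : 1 <= q -> 0 <= t <= 1 ->
  0 <= a1 -> 0 <= b1 -> (1 - t) * a1 `^ q + t * b1 `^ q = 1 ->
  0 <= a -> 0 <= b ->
  (1 - t) * a1 `^ (q - 1) * a + t * b1 `^ (q - 1) * b <= pmean q t a b.
Proof.
move=> q1 t01 a10 b10 ab1 a0 b0.
have q0 : 0 < q by lra.
have /andP[t0 t1] := t01.
set M := pmean q t a b; have M0 : 0 <= M by exact: pmean_ge0.
have Mq : M `^ q = (1 - t) * a `^ q + t * b `^ q by exact: pmean_powR.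
have [Me|Mn0] := eqVneq M 0.
  have : (1 - t) * a `^ q + t * b `^ q = 0 by rewrite -Mq Me powR0 ?gt_eqF.
  move/eqP; rewrite paddr_eq0 ?mulr_ge0 ?powR_ge0 ?subr_ge0//.
  rewrite !mulf_eq0 !powR_eq0 => /andP[A B].
  have -> : (1 - t) * a1 `^ (q - 1) * a = 0.
    by move: A => /orP[/eqP->|/andP[/eqP-> _]]; rewrite ?mul0r ?mulr0.
  have -> : t * b1 `^ (q - 1) * b = 0.
    by move: B => /orP[/eqP->|/andP[/eqP-> _]]; rewrite ?mul0r ?mulr0.
  by rewrite addr0.
have {Mn0}M0 : 0 < M by rewrite lt_neqAle eq_sym Mn0.
have aM0 : 0 <= a / M by rewrite divr_ge0// ltW.
have bM0 : 0 <= b / M by rewrite divr_ge0// ltW.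
have ab : (1 - t) * (a / M) `^ q + t * (b / M) `^ q = 1.
  have Mi : (M^-1) `^ q = (M `^ q)^-1.
    by rewrite -powR_inv1 ?(ltW M0)// -powRrM mulN1r powRN.
  rewrite !powRM ?invr_ge0 ?(ltW M0)// Mi !mulrA -mulrDl -Mq divff// gt_eqF//.
  exact: powR_gt0.
have ya := young_powR q1 a10 aM0; have yb := young_powR q1 b10 bM0.
have h : q * ((1 - t) * (a1 `^ (q - 1) * (a / M)) + t * (b1 `^ (q - 1) * (b / M))) <= q.
  have {}ya := ler_wpM2l (_ : 0 <= 1 - t) ya.
  have {}yb := ler_wpM2l t0 yb.
  have s0 : 0 <= 1 - t by rewrite subr_ge0.
  have := lerD (ya s0) yb => {ya yb}.
  have -> : (1 - t) * ((q - 1) * a1 `^ q + (a / M) `^ q) +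
      t * ((q - 1) * b1 `^ q + (b / M) `^ q) =
      (q - 1) * ((1 - t) * a1 `^ q + t * b1 `^ q) +
      ((1 - t) * (a / M) `^ q + t * (b / M) `^ q) by ring.
  rewrite ab ab1; move=> h'; apply: (le_trans _ (le_trans h' _)); last by lra.
  by rewrite le_eqVlt; apply/orP; left; apply/eqP; ring.
have -> : (1 - t) * a1 `^ (q - 1) * a + t * b1 `^ (q - 1) * b =
  M * ((1 - t) * (a1 `^ (q - 1) * (a / M)) + t * (b1 `^ (q - 1) * (b / M))).
  by field; rewrite gt_eqF.
rewrite -[leRHS]mulr1 ler_pM2l//.
by rewrite -(ler_pM2l q0) mulr1.
Qed.

Lemma rat_approx_below (x e : R) : 0 <= x -> 0 < e ->
  exists s : rat, 0 <= (ratr s : R) /\ ratr s <= x <= ratr s + e.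
Proof.
move=> x0 e0; have [->|xn0] := eqVneq x 0.
  by exists 0; rewrite rmorph0 add0r lexx (ltW e0).
have {xn0}x0 : 0 < x by rewrite lt_neqAle eq_sym xn0.
have lt : Num.max 0 (x - e) < x by rewrite gt_max x0/= gtrBl.
have [s] := rat_in_itvoo lt; rewrite in_itv/= gt_max => /andP[/andP[s0 sx] sx'].
by exists s; rewrite ltW// (ltW sx')/= -lerBlDr ltW.
Qed.

(** A norm on the quadrant is the supremum of its linear minorants.  Rational
    coefficients suffice: lowering the coefficients of the tangent at [(a, b)] keeps
    it a minorant and changes its value at [(a, b)] very little.  Countably many
    minorants are needed because each of them is used up to a null set. *)
Lemma pmean_sup q t a b z : 1 <= q -> 0 <= t <= 1 -> 0 <= a -> 0 <= b -> 0 <= z ->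
  (forall s1 s2 : rat, 0 <= (ratr s1 : R) -> 0 <= (ratr s2 : R) ->
    (forall x y, 0 <= x -> 0 <= y -> ratr s1 * x + ratr s2 * y <= pmean q t x y) ->
    ratr s1 * a + ratr s2 * b <= z) ->
  pmean q t a b <= z.
Proof.
move=> q1 t01 a0 b0 z0 h; rewrite leNgt; apply/negP => zM.
have /andP[t0 t1] := t01.
set M := pmean q t a b in zM *.
have M0 : 0 < M by exact: le_lt_trans zM.
have q0 : 0 < q by lra.
pose a1 := a / M; pose b1 := b / M.
have a10 : 0 <= a1 by rewrite divr_ge0// ltW.
have b10 : 0 <= b1 by rewrite divr_ge0// ltW.
have ab1 : (1 - t) * a1 `^ q + t * b1 `^ q = 1.
  have Mi : (M^-1) `^ q = (M `^ q)^-1.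
    by rewrite -powR_inv1 ?(ltW M0)// -powRrM mulN1r powRN.
  rewrite /a1 /b1 !powRM ?invr_ge0 ?(ltW M0)// Mi !mulrA -mulrDl -pmean_powR//.
  by rewrite divff// gt_eqF// powR_gt0.
pose al := (1 - t) * a1 `^ (q - 1); pose be := t * b1 `^ (q - 1).
have al0 : 0 <= al by rewrite mulr_ge0 ?powR_ge0 ?subr_ge0.
have be0 : 0 <= be by rewrite mulr_ge0 ?powR_ge0.
have tang x y : 0 <= x -> 0 <= y -> al * x + be * y <= pmean q t x y.
  exact: pmean_tangent.
have alM : al * a + be * b = M.
  have aE : a = M * a1 by rewrite /a1 mulrCA divff ?mulr1// gt_eqF.
  have bE : b = M * b1 by rewrite /b1 mulrCA divff ?mulr1// gt_eqF.
  rewrite {1}aE {1}bE /al /be.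
  transitivity (M * ((1 - t) * a1 `^ q + t * b1 `^ q)); last by rewrite ab1 mulr1.
  rewrite -(mulr_powRB1 a10 q0) -(mulr_powRB1 b10 q0); ring.
pose e := (M - z) / (2 * (a + b + 1)).
have e0 : 0 < e by rewrite divr_gt0//; lra.
have [s1 [s10 /andP[s1al als1]]] := rat_approx_below al0 e0.
have [s2 [s20 /andP[s2be bes2]]] := rat_approx_below be0 e0.
have : ratr s1 * a + ratr s2 * b <= z.
  apply: (h s1 s2 s10 s20) => x y x0 y0; apply: le_trans (tang x y x0 y0).
  by apply: lerD; apply: ler_wpM2r.
have ea : al * a <= ratr s1 * a + e * a by rewrite -mulrDl ler_wpM2r.
have eb : be * b <= ratr s2 * b + e * b by rewrite -mulrDl ler_wpM2r.
have eab : e * a + e * b <= (M - z) / 2.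
  have -> : e * a + e * b = (M - z) / 2 * ((a + b) / (a + b + 1)).
    by rewrite /e; field; rewrite gt_eqF//; lra.
  rewrite ler_piMr//; first by lra.
  by rewrite ler_pdivrMr; lra.
lra.
Qed.

End power_means.

(** * Norms of simple functions *)

Section norms.
Context d (Y : measurableType d) (R : realType).
Variables (nu : {measure set Y -> \bar R}) (r : \bar R).
Hypothesis r1 : (1 <= r)%E.

Local Notation N f := ('N[nu]_r[EFin \o f])%E.

Let mnorm_powR (f : Y -> R) s : measurable_fun setT f ->
  measurable_fun setT (fun y => `|f y| `^ s).
Proof.
move=> mf; apply: (measurableT_comp (measurable_powR s)).
exact: measurableT_comp.
Qed.

Lemma Lnorm_le (f g : Y -> R) : measurable_fun setT f -> measurable_fun setT g ->
  (forall y, `|f y| <= `|g y|) -> (N f <= N g)%E.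
Proof.
move=> mf mg fg; rewrite unlock /Lnorm; case: r r1 => [s||//].
- rewrite lee_fin => s1.
  have I0 (h : Y -> R) : (\int[nu]_x `|(EFin \o h) x| `^ s)%E \in `[0%E, +oo%E].
    by rewrite in_itv/= leey andbT; apply: integral_ge0 => x _; rewrite /= lee_fin powR_ge0.
  apply: gt0_ler_poweR => //; first by rewrite invr_ge0; lra.
  apply: le_integral_fin; [exact: mnorm_powR|exact: mnorm_powR| |].
  - by move=> x; exact: powR_ge0.
  - by move=> x; apply: ge0_ler_powR; rewrite ?nnegrE//; lra.
- move=> _; case: ifP => // _; apply: le_ess_sup; apply: aeW => y /=.
  by rewrite lee_fin.
Qed.

Lemma Lnorm_scale (f : {sfun Y >-> R}) (a : R) : finite_norm nu r f ->
  (N (scale_sfun a f) = `|a|%:E * N f)%E.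
Proof.
move=> fin; have fL : (f : Y -> R) \in Lfun nu r.
  rewrite inE /=; apply/andP; split; rewrite inE //=; exact: measurable_funPT.
rewrite -(LnormZ (Lfun_Sub r1 fL) a); congr (Lnorm _ _ _).
by apply/funext => y /=; rewrite mulrC.
Qed.

(** The unit ball of [L^r] is [q]-convex for [q <= r]: for finite [r] by
    convexity of the power [r / q], and for [r = +oo] pointwise. *)
Lemma Lnorm_pmean (f g h : {sfun Y >-> R}) (q t : R) : 1 <= q -> (q%:E <= r)%E ->
  0 <= t <= 1 -> (forall y, 0 <= f y) -> (forall y, 0 <= g y) ->
  (forall y, h y = pmean q t (f y) (g y)) ->
  (N f <= 1%:E)%E -> (N g <= 1%:E)%E -> (N h <= 1%:E)%E.
Proof.
move=> q1 qr t01 f0 g0 hE.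
have q0 : 0 < q by lra.
have /andP[t0 t1] := t01.
have s0 : 0 <= 1 - t by rewrite subr_ge0.
rewrite unlock /Lnorm; case: r r1 qr => [s||//].
- rewrite !lee_fin => s1 qs.
  have I0 (k : Y -> R) : (0 <= \int[nu]_x `|(EFin \o k) x| `^ s)%E.
    by apply: integral_ge0 => x _; rewrite /= lee_fin powR_ge0.
  have root (k : Y -> R) : (((\int[nu]_x `|(EFin \o k) x| `^ s) `^ s^-1 <= 1%:E) <->
      (\int[nu]_x (`|k x| `^ s)%:E <= 1%:E))%E.
    have -> : (\int[nu]_x (`|k x| `^ s)%:E = \int[nu]_x `|(EFin \o k) x| `^ s)%E by [].
    set i := (\int[nu]_x _)%E; split => h1.
      have -> : i = ((i `^ s^-1) `^ s)%E.
        by rewrite -poweRrM mulVf ?gt_eqF ?poweRe1 ?I0//; lra.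
      rewrite -[1%:E](@poweR1r _ s); apply: gt0_ler_poweR => //; first lra.
        by rewrite in_itv/= poweR_ge0 leey.
      by rewrite in_itv/= leey andbT.
    rewrite -[1%:E](@poweR1r _ s^-1); apply: gt0_ler_poweR => //.
    - by rewrite invr_ge0; lra.
    - by rewrite in_itv/= I0 leey.
    - by rewrite in_itv/= leey andbT.
  move=> /root Nf /root Ng; apply/root.
  have P0 (k : Y -> R) y : 0 <= `|k y| `^ s by exact: powR_ge0.
  apply: (@le_trans _ _ (\int[nu]_x ((1 - t) * `|f x| `^ s + t * `|g x| `^ s)%:E)%E).
    have m1 := mnorm_powR s (@measurable_funPT _ _ _ _ f).
    have m2 := mnorm_powR s (@measurable_funPT _ _ _ _ g).
    apply: le_integral_fin => //; first exact: mnorm_powR.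
    - by apply: measurable_funD; exact: measurable_funM.
    - move=> y; rewrite hE !ger0_norm ?pmean_ge0//; exact: pmean_powR_le.
  rewrite integralD_fin//.
  + rewrite !integralZl_fin//; last 2 first.
    * exact: mnorm_powR.
    * exact: mnorm_powR.
    have := leeD (lee_wpmul2l (_ : (0 <= (1 - t)%:E)%E) Nf)
      (lee_wpmul2l (_ : (0 <= t%:E)%E) Ng).
    rewrite !lee_fin => /(_ s0 t0) /le_trans; apply.
    by rewrite -!EFinM -EFinD lee_fin; lra.
  + by apply: measurable_funM => //; exact: mnorm_powR.
  + by apply: measurable_funM => //; exact: mnorm_powR.
  + by move=> x; rewrite mulr_ge0.
  + by move=> x; rewrite mulr_ge0.
- move=> _ _; case: ifP => // _ /ess_supP Nf /ess_supP Ng; apply/ess_supP.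
  apply: filterS2 Nf Ng => y /=; rewrite !lee_fin hE !ger0_norm ?pmean_ge0// => f1 g1.
  by apply: pmean_le1; rewrite ?f0 ?g0.
Qed.

Lemma simple_space_scale (a : R) (f : {sfun Y >-> R}) :
  simple_space nu r f -> simple_space nu r (scale_sfun a f).
Proof.
move=> Sf; rewrite /simple_space/= /finite_norm Lnorm_scale//.
exact: lte_mul_pinfty.
Qed.

Lemma simple_space_lin (a : R) (f g : {sfun Y >-> R}) :
  simple_space nu r f -> simple_space nu r g -> simple_space nu r (scale_sfun a f + g).
Proof.
move=> Sf Sg; rewrite /simple_space/= /finite_norm.
apply: le_lt_trans (eminkowski nu _ _ r1) _ => //.
by rewrite lte_add_pinfty//; exact: simple_space_scale.
Qed.

Lemma simple_space_le (f g : {sfun Y >-> R}) : (forall y, `|f y| <= `|g y|) ->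
  simple_space nu r g -> simple_space nu r f.
Proof. by move=> fg Sg; apply: le_lt_trans Sg; exact: Lnorm_le. Qed.

End norms.

Lemma exists_sfun_comp2 d (Y : measurableType d) (R : realType) (f g : {sfun Y >-> R})
    (F : R -> R -> R) : measurable_fun setT (fun y => F (f y) (g y)) ->
  exists h : {sfun Y >-> R}, forall y, h y = F (f y) (g y).
Proof.
move=> mF; have fin : finite_set (range (fun y => F (f y) (g y))).
  apply: (@sub_finite_set _ _ [set F a b | a in range f & b in range g]).
    by move=> _ [y _ <-]; exists (f y); [exists y|exists (g y); [exists y|]].
  by apply: finite_image2; exact: fimfunP.
have hs : (fun y => F (f y) (g y)) \in @sfun _ Y R.
  by rewrite inE; apply/andP; split; rewrite inE.
by exists (sfun_Sub hs).
Qed.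

(** * Positive operators and the convex sets they generate *)

Section positive_operators.
Context dX dY (X : measurableType dX) (Y : measurableType dY) (R : realType).
Variables (mu : {measure set X -> \bar R}) (nu : {measure set Y -> \bar R}).
Variable r : \bar R.
Hypothesis r1 : (1 <= r)%E.
Local Notation S := (simple_space nu r).
Local Notation N f := ('N[nu]_r[EFin \o f])%E.
Variable T : {sfun Y >-> R} -> {mfun X >-> R}.
Hypothesis T_linear : linear_operator mu S T.
Hypothesis T_positive : positive_operator mu S T.

Lemma simple_space0 : S 0.
Proof.
rewrite /simple_space/= /finite_norm (_ : EFin \o _ = cst 0%E)// Lnorm0//.
by rewrite gt_eqF// (lt_le_trans _ r1).
Qed.

Lemma op_mono f g : S f -> S g -> (forall y, f y <= g y) ->
  {ae mu, forall x, T f x <= T g x}.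
Proof.
move=> Sf Sg fg.
have h0 y : 0 <= (scale_sfun (-1) f + g) y.
  by rewrite sfunD/= mulrN1 addrC subr_ge0.
have := T_positive (simple_space_lin r1 (-1) Sf Sg) h0.
apply: filterS2 (T_linear (-1) Sf Sg) => x ->.
by rewrite mulN1r addrC subr_ge0.
Qed.

Lemma op_scale a f : S f -> {ae mu, forall x, T (scale_sfun a f) x = a * T f x}.
Proof.
move=> Sf; have S0 := simple_space0.
have E0 : scale_sfun 1 0 + 0 = 0 :> {sfun Y >-> R}.
  by apply/sfuneqP => y; rewrite sfunD/= mulr1 addr0.
have Ea : scale_sfun a f + 0 = scale_sfun a f.
  by apply/sfuneqP => y; rewrite sfunD/= addr0.
apply: filterS2 (T_linear 1 S0 S0) (T_linear a Sf S0) => x.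
rewrite E0 Ea mul1r => T0 ->; lra.
Qed.

Lemma op_norm_le f k : S f -> S k -> (forall y, k y = `|f y|) ->
  {ae mu, forall x, `|T f x| <= T k x}.
Proof.
move=> Sf Sk kE.
have Smf : S (scale_sfun (-1) f).
  exact: simple_space_scale.
have le1 := op_mono Sf Sk (fun y => _); have le2 := op_mono Smf Sk (fun y => _).
have {}le1 := le1 (fun y => _); have {}le2 := le2 (fun y => _).
have A1 : {ae mu, forall x, T f x <= T k x}.
  by apply: le1 => y; rewrite kE ler_norm.
have A2 : {ae mu, forall x, T (scale_sfun (-1) f) x <= T k x}.
  by apply: le2 => y /=; rewrite kE mulrN1 -normrN ler_norm.
apply: filterS3 A1 A2 (op_scale (-1) Sf) => x h1 h2 h3.
by rewrite ler_norml h1 andbT lerNl -mulN1r -h3.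
Qed.

(** A positive operator maps a linear minorant of [h] to a linear minorant of
    [T h]; the supremum over countably many of them gives the inequality
    [pmean (T f) (T g) <= T (pmean f g)], which for [q > 1] is not a consequence of
    linearity alone. *)
Lemma op_pmean f g h q t : 1 <= q -> 0 <= t <= 1 -> S f -> S g -> S h ->
  (forall y, 0 <= f y) -> (forall y, 0 <= g y) ->
  (forall y, h y = pmean q t (f y) (g y)) ->
  {ae mu, forall x, [/\ 0 <= T f x, 0 <= T g x &
    pmean q t (T f x) (T g x) <= T h x]}.
Proof.
move=> q1 t01 Sf Sg Sh f0 g0 hE.
pose ok (s : rat * rat) := [/\ 0 <= (ratr s.1 : R), 0 <= (ratr s.2 : R) &
  forall x y, 0 <= x -> 0 <= y -> ratr s.1 * x + ratr s.2 * y <= pmean q t x y].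
have minorant s : ok s ->
    {ae mu, forall x, ratr s.1 * T f x + ratr s.2 * T g x <= T h x}.
  move=> [s10 s20 sle].
  pose k := scale_sfun (ratr s.1) f + scale_sfun (ratr s.2) g.
  have Ssg : S (scale_sfun (ratr s.2) g) by exact: simple_space_scale.
  have Sk : S k by exact: simple_space_lin.
  have kh : {ae mu, forall x, T k x <= T h x}.
    apply: op_mono => // y; rewrite /k !sfunD/= hE.
    by rewrite /= [f y * _]mulrC [g y * _]mulrC; exact: sle.
  apply: filterS3 kh (T_linear (ratr s.1) Sf Ssg) (op_scale (ratr s.2) Sg) => x.
  by move=> + E1 E2; rewrite /k E1 E2.
have all_minorants : {ae mu, forall x, forall n, forall s, unpickle n = Some s ->
    ok s -> ratr s.1 * T f x + ratr s.2 * T g x <= T h x}.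
  apply: ae_foralln => n; case: (unpickle n) => [s|]; last exact/aeW.
  have [oks|nok] := pselect (ok s); last by apply: aeW => x _ [<-] /nok.
  by apply: filterS (minorant s oks) => x hx _ [<-].
have h0 y : 0 <= h y by rewrite hE pmean_ge0.
apply: filterS2 all_minorants (filterI (T_positive Sf f0)
  (filterI (T_positive Sg g0) (T_positive Sh h0))) => x min [Tf0 [Tg0 Th0]].
split => //; apply: pmean_sup => // s1 s2 s10 s20 sle.
by apply: (min (pickle (s1, s2)) (s1, s2)); [exact: pickleK|split].
Qed.

(** The solid hull, among nonnegative measurable functions, of the [p]-th powers
    of the image under [T / A] of the nonnegative part of the unit ball. *)
Definition level p A : set (X -> R) := [set u : X -> R |
  [/\ measurable_fun setT u, forall x, 0 <= u x & exists f,
     [/\ S f, forall y, 0 <= f y, (N f <= 1%:E)%E &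
         {ae mu, forall x, u x <= (T f x / A) `^ p}]]].

Variables (p A : R).
Hypotheses (p0 : 0 < p) (pr : (p%:E <= r)%E) (A0 : 0 < A).

(** Convexity is witnessed by the power mean [h] of [f] and [g] with exponent
    [q = max 1 p].  The bound [q <= r] keeps [h] in the unit ball, [1 <= q] makes
    the power mean a norm, so that positivity of [T] applies, and [p <= q] compares
    the means of order [p] and [q]. *)
Lemma level_convex u v t : 0 <= t <= 1 -> level p A u -> level p A v ->
  level p A (fun x => (1 - t) * u x + t * v x).
Proof.
move=> t01 [mu_ u0 [f [Sf f0 f1 uf]]] [mv v0 [g [Sg g0 g1 vg]]].
have /andP[t0 t1] := t01.
split; first by apply: measurable_funD; exact: measurable_funM.
  by move=> x; exact: convex_comb_ge0.
pose q := Num.max 1 p.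
have q1 : 1 <= q by rewrite le_max lexx.
have q0 : 0 < q by lra.
have pq : p <= q by rewrite le_max lexx orbT.
have qr : (q%:E <= r)%E by rewrite EFin_max ge_max r1 pr.
have mF : measurable_fun setT (fun y => pmean q t (f y) (g y)).
  apply: (measurableT_comp (measurable_powR q^-1)).
  apply: measurable_funD; apply: measurable_funM => //;
    by apply: (measurableT_comp (measurable_powR q)).
have [h hE] := exists_sfun_comp2 mF.
have h1 : (N h <= 1%:E)%E by exact: (Lnorm_pmean r1 q1 qr t01 f0 g0).
have Sh : S h by apply: le_lt_trans h1 _; rewrite ltry.
exists h; split => //; first by move=> y; rewrite hE pmean_ge0.
apply: filterS3 uf vg (op_pmean q1 t01 Sf Sg Sh f0 g0 hE) => x ux vx [Tf0 Tg0 Th].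
have s0 : 0 <= 1 - t by rewrite subr_ge0.
apply: (@le_trans _ _ ((1 - t) * (T f x / A) `^ p + t * (T g x / A) `^ p)).
  by apply: lerD; apply: ler_wpM2l.
rewrite !powRM ?invr_ge0 ?(ltW A0)// ?(le_trans (pmean_ge0 _ _ _ _) Th)//.
rewrite !mulrA -mulrDl; apply: ler_wpM2r; first exact: powR_ge0.
apply: le_trans (pmean_le_powR p0 pq t01 Tf0 Tg0) _.
by apply: ge0_ler_powR; rewrite ?nnegrE ?pmean_ge0 ?(ltW p0)//
  (le_trans (pmean_ge0 _ _ _ _) Th).
Qed.

(** Signed functions enter through [|T f| <= T |f|].  The normalising constant
    [s] is only an upper bound of the norm, so that functions of norm [0] are not
    an exception. *)
Lemma level_normalised f s : S f -> 0 < s -> (N f <= s%:E)%E ->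
  level p A (fun x => (`|T f x| / (s * A)) `^ p).
Proof.
move=> Sf s0 fs.
have mabs : measurable_fun setT (fun y => `|f y|) by exact: measurableT_comp.
have [k kE] := @exists_sfun_comp2 _ _ _ f f (fun a _ => `|a|) mabs.
have Sk : S k by apply: simple_space_le Sf => // y; rewrite kE normr_id.
have kf : (N k <= N f)%E by apply: Lnorm_le => // y; rewrite kE normr_id.
split => [|x|].
- apply: (measurableT_comp (measurable_powR p)).
  by apply: measurable_funM => //; exact: measurableT_comp.
- exact: powR_ge0.
exists (scale_sfun s^-1 k); split.
- exact: simple_space_scale.
- by move=> y /=; rewrite mulr_ge0 ?kE// invr_ge0 ltW.
- rewrite Lnorm_scale// ger0_norm ?invr_ge0 ?(ltW s0)//.
  by rewrite lee_pdivrMl// mule1 (le_trans kf).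
- apply: filterS2 (op_scale s^-1 Sk) (op_norm_le Sf Sk kE) => x -> le.
  have le0 : 0 <= T k x by exact: le_trans le.
  have As : 0 <= (s * A)^-1 by rewrite invr_ge0 mulr_ge0 ?ltW.
  have -> : s^-1 * T k x / A = T k x / (s * A) by rewrite invfM; ring.
  apply: ge0_ler_powR; rewrite ?nnegrE ?(ltW p0) ?mulr_ge0//.
  exact: ler_wpM2r.
Qed.

Lemma level_nonempty : level p A !=set0.
Proof.
exists (fun x => (`|T 0 x| / (1 * A)) `^ p); apply: level_normalised => //.
  exact: simple_space0.
rewrite (_ : EFin \o _ = cst 0%E)// Lnorm0 ?lee_fin//.
by rewrite gt_eqF// (lt_le_trans _ r1).
Qed.

Lemma level_saturates : saturates mu S T -> forall E, measurable E -> (0 < mu E)%E ->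
  exists E' u, [/\ measurable E', E' `<=` E, (0 < mu E')%E, level p A u &
    forall x, E' x -> 0 < u x].
Proof.
move=> sat E mE E0; have [E' [mE' E'E E'0 [h [Sh [M [mM M0 hM]]]]]] := sat E mE E0.
pose s := 1 + fine (N h).
have s0 : 0 < s by rewrite ltr_pwDl// fine_ge0// Lnorm_ge0.
have hs : (N h <= s%:E)%E.
  have hfin : N h \is a fin_num by rewrite ge0_fin_numE// Lnorm_ge0.
  by rewrite /s -[leLHS]fineK// lee_fin lerDr.
exists (E' `\` M), (fun x => (`|T h x| / (s * A)) `^ p); split.
- exact: measurableD.
- by move=> x [/E'E].
- have muE' : (mu E' = mu (E' `\` M) + mu (E' `&` M))%E by exact: measureDI.
  have E'M0 : mu (E' `&` M) = 0.
    by apply: subset_measure0 M0 => //; exact: measurableI.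
  by move: muE'; rewrite E'M0 adde0 => <-.
- exact: level_normalised.
- move=> x [E'x nM]; apply: powR_gt0; apply: divr_gt0; last exact: mulr_gt0.
  by have := contra_notP (hM x) nM; exact.
Qed.

End positive_operators.

(** * The multilinear inequality *)

Section multilinear_bound.
Context (R : realType) (d : nat) (dX : measure_display) (X : measurableType dX).
Variable mu : {measure set X -> \bar R}.
Context (dY : 'I_d -> measure_display) (Y : forall j : 'I_d, measurableType (dY j)).
Variables (nu : forall j : 'I_d, {measure set (Y j) -> \bar R}) (r : 'I_d -> \bar R).
Variables (gamma p : 'I_d -> R) (A : R).
Hypotheses (gamma0 : forall j, 0 < gamma j) (p0 : forall j, 0 < p j).
Variable T : forall j : 'I_d, {sfun (Y j) >-> R} -> {mfun X >-> R}.
Arguments T : clear implicits.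
Hypothesis T_positive :
  forall j, positive_operator mu (simple_space (nu j) (r j)) (T j).
Hypothesis T_bound : forall f : (forall j : 'I_d, {sfun (Y j) >-> R}),
  (forall j, simple_space (nu j) (r j) (f j)) ->
  (forall j y, 0 <= f j y) ->
  (\int[mu]_x (\prod_(j < d) (T j (f j) x) `^ gamma j)%R%:E
    <= (A `^ (\sum_(j < d) gamma j))%R%:E
       * \prod_(j < d) 'N[nu j]_(r j)[EFin \o f j] `^ gamma j)%E.

(** The normalisation [a] of the sets [level] is left free: the value [a = A]
    gives the bound [1] needed for the factorisation, and [a = 1] serves to exclude
    [A = 0]. *)
Lemma level_bound (a : R) (u : 'I_d -> X -> R) : 0 < a ->
  (forall j, level mu (nu j) (r j) (T j) (p j) a (u j)) ->
  (\int[mu]_x (geomean (fun j => gamma j / p j) u x)%:E <=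
    (A `^ (\sum_j gamma j) / a `^ (\sum_j gamma j))%:E)%E.
Proof.
move=> a0 lu.
have mu_ j : measurable_fun setT (u j) by have [] := lu j.
have u0 j x : 0 <= u j x by have [_ h _] := lu j; exact: h.
have ex j : exists f : {sfun (Y j) >-> R}, [/\ simple_space (nu j) (r j) f,
    forall y, 0 <= f y, ('N[nu j]_(r j)[EFin \o f] <= 1%:E)%E &
    {ae mu, forall x, u j x <= (T j f x / a) `^ p j}] by have [_ _ h] := lu j; exact: h.
pose f j := sval (cid (ex j)).
have fP j : [/\ simple_space (nu j) (r j) (f j), forall y, 0 <= f j y,
    ('N[nu j]_(r j)[EFin \o f j] <= 1%:E)%E &
    {ae mu, forall x, u j x <= (T j (f j) x / a) `^ p j}] by exact: (svalP (cid (ex j))).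
have Sf j : simple_space (nu j) (r j) (f j) by have [] := fP j.
have f0 j y : 0 <= f j y by have [_ h _ _] := fP j; exact: h.
pose G x := \prod_(j < d) T j (f j) x `^ gamma j.
have G0 x : 0 <= G x by apply: prodr_ge0 => j _; exact: powR_ge0.
have mG : measurable_fun setT G.
  apply: measurable_prod => j _.
  exact: (measurableT_comp (measurable_powR (gamma j))).
have aG0 : 0 < a `^ (\sum_j gamma j) by exact: powR_gt0.
apply: (@le_trans _ _ (\int[mu]_x ((a `^ (\sum_j gamma j))^-1 * G x)%:E)%E).
  apply: ae_le_integral_fin.
  - exact: measurable_geomean.
  - exact: measurable_funM.
  - exact: geomean_ge0.
  - by move=> x; rewrite mulr_ge0// invr_ge0 ltW.
  have H : {ae mu, forall x j, u j x <= (T j (f j) x / a) `^ p j /\ 0 <= T j (f j) x}.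
    apply: filter_forall => j; have [_ _ _ h] := fP j.
    exact: filterI h (T_positive (Sf j) (f0 j)).
  apply: filterS H => x hx.
  rewrite powR_sum// -prodfV mulrC /G -big_split/=.
  apply: ler_prod => j _; rewrite powR_ge0/=.
  have [ule T0] := hx j.
  have -> : T j (f j) x `^ gamma j / a `^ gamma j =
      ((T j (f j) x / a) `^ p j) `^ (gamma j / p j).
    rewrite -[RHS]powRrM [p j * _]mulrC divfK ?gt_eqF// powRM ?invr_ge0 ?(ltW a0)//.
    by rewrite -[a^-1]powR_inv1 ?(ltW a0)// -powRrM mulN1r powRN.
  by apply: ge0_ler_powR; rewrite ?nnegrE ?powR_ge0 ?divr_ge0 ?(ltW (p0 j)) ?(ltW (gamma0 j)).
rewrite integralZl_fin//; last by rewrite invr_ge0 ltW.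
rewrite mulrC EFinM; apply: lee_wpmul2l; first by rewrite lee_fin invr_ge0 ltW.
apply: le_trans (T_bound Sf f0) _.
rewrite -[leRHS]mule1; apply: lee_wpmul2l; first by rewrite lee_fin powR_ge0.
suff /andP[] : (0 <= \prod_(j < d) 'N[nu j]_(r j)[EFin \o f j] `^ gamma j <= 1)%E by [].
apply: (big_ind (fun x : \bar R => 0 <= x <= 1)%E) => [|x y|j _].
- by rewrite lee01 lexx.
- move=> /andP[x0 x1] /andP[y0 y1]; rewrite mule_ge0//=.
  by rewrite -[leRHS]mule1; exact: lee_pmul.
- rewrite poweR_ge0/= -[leRHS](@poweR1r _ (gamma j)).
  have [_ _ h _] := fP j.
  apply: gt0_ler_poweR => //; first exact: ltW.
  + by rewrite in_itv/= Lnorm_ge0 leey.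
  + by rewrite in_itv/= leey andbT.
Qed.

End multilinear_bound.

Theorem theorem1p3 (R : realType) (d : nat) (hd : (1 <= d)%N)
    (dX : measure_display) (X : measurableType dX)
    (mu : {sigma_finite_measure set X -> \bar R})
    (dY : 'I_d -> measure_display)
    (Y : forall j : 'I_d, measurableType (dY j))
    (nu : forall j : 'I_d, {measure set (Y j) -> \bar R})
    (r : 'I_d -> \bar R) (hr : forall j, (1%:E <= r j)%E)
    (gamma : 'I_d -> R) (hgamma : forall j, 0 < gamma j)
    (T : forall j : 'I_d, {sfun (Y j) >-> R} -> {mfun X >-> R})
    (T_linear : forall j, linear_operator mu (simple_space (nu j) (r j)) (T j))
    (T_positive :
      forall j, positive_operator mu (simple_space (nu j) (r j)) (T j))
    (T_saturates : forall j, saturates mu (simple_space (nu j) (r j)) (T j))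
    (A : R) (hA : 0 <= A)
    (T_bound : forall f : (forall j : 'I_d, {sfun (Y j) >-> R}),
      (forall j, simple_space (nu j) (r j) (f j)) ->
      (forall j y, 0 <= f j y) ->
      (\int[mu]_x (\prod_(j < d) (T j (f j) x) `^ gamma j)%R%:E
        <= (A `^ (\sum_(j < d) gamma j))%R%:E
           * \prod_(j < d) 'N[nu j]_(r j)[EFin \o f j] `^ gamma j)%E)
    (p : 'I_d -> R) (hp : forall j, 0 < p j)
    (hgp : \sum_(j < d) gamma j / p j = 1)
    (hpr : forall j, ((p j)%:E <= r j)%E) :
  exists phi : 'I_d -> {mfun X >-> R},
    [/\ forall j x, 0 <= phi j x,
        {ae mu, forall x, 1 <= \prod_(j < d) (phi j x) `^ (gamma j / p j)} &
        forall (j : 'I_d) (f : {sfun (Y j) >-> R}),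
          simple_space (nu j) (r j) f ->
          ((\int[mu]_x (`|T j f x| `^ p j * phi j x)%R%:E) `^ (p j)^-1
            <= A%:E * 'N[nu j]_(r j)[EFin \o f])%E].
Proof.
have theta0 j : 0 < gamma j / p j by exact: divr_gt0.
have [muX0|muXn0] := eqVneq (mu setT) 0%E.
  (* On a null space every choice of weights will do. *)
  exists (fun _ => cst 0); split => //; first exact: measure0_ae.
  move=> j f Sf; under eq_integral do rewrite /= mulr0.
  rewrite integral0 poweR0r ?invr_eq0 ?gt_eqF//.
  by rewrite mule_ge0 ?lee_fin// Lnorm_ge0.
have muX0 : (0 < mu setT)%E by rewrite lt0e muXn0 measure_ge0.
have sat a (a0 : 0 < a) j := level_saturates (hr j) (T_linear j) (T_positive j)
  (hp j) a0 (T_saturates j).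
have {hA}A0 : 0 < A.
  rewrite lt_neqAle hA andbT eq_sym; apply/eqP => A0.
  (* If A = 0, the geometric mean of a jointly saturating tuple has integral 0,
     although it is positive on a set of positive measure. *)
  have [E [c [mE _ E0 lc c0]]] := joint_saturation (sat 1 ltr01) measurableT muX0.
  have := level_bound hgamma hp T_positive T_bound ltr01 lc.
  rewrite A0 powR0; last first.
    apply/eqP => s0; move: hgp; rewrite big1; first by move/esym/eqP; rewrite oner_eq0.
    move=> j _; have := hgamma j; rewrite ltNge -s0 (bigD1 j)//= lerDl.
    by rewrite sumr_ge0// => i _; exact: ltW.
  rewrite mul0r; set G := geomean _ c => G0.
  have mG : measurable_fun setT (fun x => (G x)%:E).
    by apply/measurable_EFinP; apply: measurable_geomean => j; have [] := lc j.
  have : (\int[mu]_x `|(G x)%:E| = 0)%E.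
    apply/eqP; rewrite eq_le integral_ge0// andbT.
    by under eq_integral do rewrite gee0_abs ?lee_fin ?geomean_ge0//.
  move/(ae_eq_integral_abs mu measurableT mG) => [N [mN N0 GN]].
  have EN : E `<=` N.
    move=> x Ex; apply: GN => /= /(_ I) [] /eqP; apply/negP; rewrite gt_eqF//.
    by apply: prodr_gt0 => j _; apply: powR_gt0; exact: c0.
  move: E0; rewrite ltNge => /negP; apply.
  by rewrite -N0; apply: le_measure; rewrite ?inE.
pose C j := level mu (nu j) (r j) (T j) (p j) A.
have C_bound u : (forall j, C j (u j)) ->
    (\int[mu]_x (geomean (fun j => gamma j / p j) u x)%:E <= 1%:E)%E.
  move=> lu; apply: le_trans (level_bound hgamma hp T_positive T_bound A0 lu) _.
  by rewrite divff// gt_eqF// powR_gt0.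
have [phi [mphi phi0 phi1 phiC]] := @factorisation _ _ _ mu _ _ C theta0 hgp
  (fun j u (h : C j u) => let: And3 h1 _ _ := h in h1)
  (fun j u (h : C j u) => let: And3 _ h2 _ := h in h2)
  (fun j u v t => @level_convex _ _ _ _ _ _ _ _ (hr j) _ (T_linear j) (T_positive j)
     _ _ (hp j) (hpr j) A0 u v t)
  (fun j => level_nonempty (hr j) (T_linear j) (T_positive j) (hp j) A0)
  (sat A A0) C_bound.
have phim j : phi j \in mfun by rewrite inE; exact: mphi.
exists (fun j => mfun_Sub (phim j)); split => // j f Sf /=.
(* The slack e lets f be normalised by s > 0 even when its norm is 0. *)
apply/lee_addgt0Pr => e e0.
have fin : 'N[nu j]_(r j)[EFin \o f]%E \is a fin_num.
  by rewrite ge0_fin_numE// Lnorm_ge0.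
have N0 : 0 <= fine 'N[nu j]_(r j)[EFin \o f]%E by rewrite fine_ge0// Lnorm_ge0.
pose s := fine 'N[nu j]_(r j)[EFin \o f]%E + e / A.
have s0 : 0 < s by rewrite ltr_wpDl// divr_gt0.
have fs : ('N[nu j]_(r j)[EFin \o f] <= s%:E)%E.
  by rewrite -[leLHS]fineK// lee_fin /s lerDl divr_ge0// ltW.
have sA0 : 0 < s * A by exact: mulr_gt0.
have Cf := level_normalised (hr j) (T_linear j) (T_positive j) (hp j) A0 Sf s0 fs.
have [mCf Cf0 _] := Cf.
have -> : (\int[mu]_x (`|T j f x| `^ p j * phi j x)%:E =
    ((s * A) `^ p j)%:E * \int[mu]_x ((`|T j f x| / (s * A)) `^ p j * phi j x)%:E)%E.
  rewrite -integralZl_fin.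
  - apply: eq_integral => x _; rewrite mulrA -powRM ?divr_ge0 ?(ltW sA0)//.
    by rewrite [s * A * _]mulrC divfK ?gt_eqF.
  - exact: measurable_funM.
  - by move=> x; rewrite mulr_ge0.
  - exact: powR_ge0.
have -> : (A%:E * 'N[nu j]_(r j)[EFin \o f] + e%:E = ((s * A) `^ p j)%:E `^ (p j)^-1)%E.
  rewrite poweR_EFin -powRrM divff ?gt_eqF// powRr1 ?(ltW sA0)//.
  by rewrite -[in LHS](fineK fin) -EFinM -EFinD /s mulrDl divfK ?gt_eqF// mulrC.
have I0 : (0 <= \int[mu]_x ((`|T j f x| / (s * A)) `^ p j * phi j x)%:E)%E.
  by apply: integral_fin_ge0 => x; rewrite mulr_ge0.
apply: gt0_ler_poweR.
- by rewrite invr_ge0 ltW.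
- by rewrite in_itv/= leey andbT mule_ge0 ?lee_fin ?powR_ge0.
- by rewrite in_itv/= leey andbT lee_fin powR_ge0.
- rewrite -[leRHS]mule1; apply: lee_wpmul2l; first by rewrite lee_fin powR_ge0.
  exact: phiC.
Qed.
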